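(* Consider the decentralized LQR problem of minimizing $J(K)=\operatorname{trace}(P(K)D_0)$ over $K\in\mathcal M\cap\mathcal S$. Suppose that $C$ has full row rank and that the block matrix $\begin{bmatrix} R_1 & R_{12}\\ R_{12}^\top & R_2\end{bmatrix}$ is positive definite. Suppose further that $J$ (as a function on $\mathcal M\cap\mathcal S$) satisfies the strict saddle property and that all of its local minima are strict. Then there is a set $N\subset\mathcal M\cap\mathcal S$ of Lebesgue measure zero in $\mathcal S$ such that from every initial stabilizing controller $K^0\in(\mathcal M\cap\mathcal S)\setminus N$ there is a path to a globally optimal decentralized controller (a global minimizer of $J$ over $\mathcal M\cap\mathcal S$) that involves only descent directions.
   Context: Setting. Let $A\in\mathbb R^{n\times n}$, $B\in\mathbb R^{n\times m}$, $C\in\mathbb R^{p\times n}$, and consider the linear time-invariant system $\dot x=Ax+Bu$, $y=Cx$, with static output feedback $u=-Ky$, $K\in\mathbb R^{m\times p}$. The initial state is random with zero mean and positive definite covariance $D_0\in\mathbb R^{n\times n}$. The weights are $R_1\in\mathbb R^{n\times n}$ symmetric, $R_{12}\in\mathbb R^{n\times m}$, and $R_2\in\mathbb R^{m\times m}$ symmetric positive definite. $\mathcal M$ is the (open) set of stabilizing controllers: those $K\in\mathbb R^{m\times p}$ for which all eigenvalues of $A-BKC$ lie in the open left half-plane. $\mathcal S\subseteq\mathbb R^{m\times p}$ is the linear subspace of matrices with a prescribed sparsity pattern (certain entries are required to be $0$, all others are free); controllers in $\mathcal M\cap\mathcal S$ are called decentralized stabilizing controllers. For $K\in\mathcal M$,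 $$P(K)=\int_0^\infty e^{(A-BKC)^\top t}\big[R_1-R_{12}KC-C^\top K^\top R_{12}^\top+C^\top K^\top R_2KC\big]e^{(A-BKC)t}\,dt,$$ and $J(K)=\operatorname{trace}(P(K)D_0)$. $J$ is viewed as a function on the relatively open subset $\mathcal M\cap\mathcal S$ of the Euclidean space $\mathcal S$; gradients, Hessians, critical points and local minima are taken in this sense, with the Frobenius inner product $\langle\cdot,\cdot\rangle$ (so the gradient is the orthogonal projection onto $\mathcal S$ of the unrestricted gradient). Strict saddle property: each critical point $K^+$ of $J$ (i.e. $\nabla J(K^+)=0$) is either a local minimizer or a strict saddle, meaning that $\nabla^2J(K^+)$ has at least one strictly negative eigenvalue. Descent direction: $\tilde K\in\mathcal S$ is a descent direction at $K\in\mathcal M\cap\mathcal S$ if $\langle\nabla J(K),\tilde K\rangle<0$. A path from $K^0$ to $K^*$ that involves only descent directions: a sequence $K^0,K^1,K^2,\dots$ in $\mathcal M\cap\mathcal S$, either finite with last element $K^*$ or infinite and converging to $K^*$, such that each step $K^{i+1}-K^i$ is a positive multiple of a descent direction at $K^i$ (discrete jumps, possibly between different connected components of $\mathcal M\cap\mathcal S$, are allowed, and no decrease of $J$ along a step is required). *)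

(* Defs.v *)
From HB Require Import structures.
From mathcomp Require Import all_boot all_order all_algebra.
From mathcomp Require Import complex.
From mathcomp Require Import all_classical all_reals all_analysis.

Set Implicit Arguments.
Unset Strict Implicit.
Unset Printing Implicit Defensive.

Import Order.TTheory GRing.Theory Num.Theory.
Import numFieldNormedType.Exports.

Local Open Scope classical_set_scope.
Local Open Scope ring_scope.

Definition posdefmx (R : realType) (n : nat) (M : 'M[R]_n) : Prop :=
  M^T = M /\ forall x : 'cV[R]_n, x != 0 -> 0 < (x^T *m M *m x) 0 0.

Definition expmx (R : realType) (n : nat) (X : 'M[R]_n) : 'M[R]_n :=
  lim (series (fun k : nat => (k`!%:R : R)^-1 *: X ^+ k) @ \oo).

Definition hurwitz (R : realType) (n : nat) (X : 'M[R]_n) : Prop :=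
  forall z : R[i],
    eigenvalue (map_mx (real_complex R) X) z -> complex.Re z < 0.

Definition frob (R : realType) (m p : nat) (U V : 'M[R]_(m, p)) : R :=
  \tr (U^T *m V).

Section Lqr.
Variables (R : realType) (n m p : nat).
Variables (A : 'M[R]_n) (B : 'M[R]_(n, m)) (C : 'M[R]_(p, n)).
Variables (R1 : 'M[R]_n) (R12 : 'M[R]_(n, m)) (R2 : 'M[R]_m) (D0 : 'M[R]_n).

Definition closed_loop (K : 'M[R]_(m, p)) : 'M[R]_n := A - B *m K *m C.

Definition stabilizing : set 'M[R]_(m, p) :=
  [set K | hurwitz (closed_loop K)].

Definition lqr_weight (K : 'M[R]_(m, p)) : 'M[R]_n :=
  R1 - R12 *m K *m C - C^T *m K^T *m R12^T + C^T *m K^T *m R2 *m K *m C.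

Definition lqr_integrand (K : 'M[R]_(m, p)) (t : R) : 'M[R]_n :=
  expmx (t *: (closed_loop K)^T) *m lqr_weight K *m expmx (t *: closed_loop K).

(* Entrywise Lebesgue integral; for stabilizing K the integrand decays
   exponentially, so this is the absolutely convergent improper integral.
   For other K the value is meaningless. *)
Definition lqr_P (K : 'M[R]_(m, p)) : 'M[R]_n :=
  \matrix_(i, j) Rintegral lebesgue_measure `[0, +oo[
                   (fun t : R => lqr_integrand K t i j).

Definition lqr_cost (K : 'M[R]_(m, p)) : R := \tr (lqr_P K *m D0).

End Lqr.

Section SparseCalculus.
Variables (R : realType) (m p : nat).
(* free i j means that entry (i, j) is unconstrained. *)
Variable free : 'I_m -> 'I_p -> bool.

Definition sparse : set 'M[R]_(m, p) :=
  [set K | forall i j, ~~ free i j -> K i j = 0].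

Definition proj_sparse (K : 'M[R]_(m, p)) : 'M[R]_(m, p) :=
  \matrix_(i, j) if free i j then K i j else 0.

Definition full_gradient (f : 'M[R]_(m, p) -> R) (K : 'M[R]_(m, p))
    : 'M[R]_(m, p) :=
  \matrix_(i, j) 'D_(delta_mx i j) f K.

Definition gradient (f : 'M[R]_(m, p) -> R) (K : 'M[R]_(m, p))
    : 'M[R]_(m, p) :=
  proj_sparse (full_gradient f K).

(* The Hessian as an operator on sparse: the derivative of the gradient field. *)
Definition hessian (f : 'M[R]_(m, p) -> R) (K V : 'M[R]_(m, p))
    : 'M[R]_(m, p) :=
  'D_V (gradient f) K.

Definition hessian_eigenvalue (f : 'M[R]_(m, p) -> R) (K : 'M[R]_(m, p))
    (l : R) : Prop :=
  exists V : 'M[R]_(m, p), [/\ sparse V, V != 0 & hessian f K V = l *: V].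

(* Below, the domain D is meant to be a relatively open subset of sparse. *)
Definition critical_point (f : 'M[R]_(m, p) -> R) (D : set 'M[R]_(m, p))
    (K : 'M[R]_(m, p)) : Prop :=
  D K /\ gradient f K = 0.

Definition local_minimizer (f : 'M[R]_(m, p) -> R) (D : set 'M[R]_(m, p))
    (K : 'M[R]_(m, p)) : Prop :=
  D K /\ \forall L \near within D (nbhs K), f K <= f L.

Definition strict_local_minimizer (f : 'M[R]_(m, p) -> R)
    (D : set 'M[R]_(m, p)) (K : 'M[R]_(m, p)) : Prop :=
  D K /\ \forall L \near within D (nbhs K), L != K -> f K < f L.

Definition strict_saddle_property (f : 'M[R]_(m, p) -> R)
    (D : set 'M[R]_(m, p)) : Prop :=
  forall K, critical_point f D K ->
    local_minimizer f D K \/ exists2 l : R, l < 0 & hessian_eigenvalue f K l.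

Definition global_minimizer (f : 'M[R]_(m, p) -> R) (D : set 'M[R]_(m, p))
    (K : 'M[R]_(m, p)) : Prop :=
  D K /\ forall L, D L -> f K <= f L.

Definition descent_direction (f : 'M[R]_(m, p) -> R) (K V : 'M[R]_(m, p))
    : Prop :=
  sparse V /\ frob (gradient f K) V < 0.

Definition descent_step (f : 'M[R]_(m, p) -> R) (K L : 'M[R]_(m, p)) : Prop :=
  exists (a : R) (V : 'M[R]_(m, p)),
    [/\ 0 < a, descent_direction f K V & L - K = a *: V].

Definition finite_descent_path (f : 'M[R]_(m, p) -> R) (D : set 'M[R]_(m, p))
    (K0 K1 : 'M[R]_(m, p)) : Prop :=
  exists (N : nat) (u : nat -> 'M[R]_(m, p)),
    [/\ u 0%N = K0, u N = K1, forall k, (k <= N)%N -> D (u k)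
      & forall k, (k < N)%N -> descent_step f (u k) (u k.+1)].

Definition infinite_descent_path (f : 'M[R]_(m, p) -> R)
    (D : set 'M[R]_(m, p)) (K0 K1 : 'M[R]_(m, p)) : Prop :=
  exists u : nat -> 'M[R]_(m, p),
    [/\ u 0%N = K0, forall k, D (u k),
        forall k, descent_step f (u k) (u k.+1) & u @ \oo --> K1].

Definition descent_path (f : 'M[R]_(m, p) -> R) (D : set 'M[R]_(m, p))
    (K0 K1 : 'M[R]_(m, p)) : Prop :=
  finite_descent_path f D K0 K1 \/ infinite_descent_path f D K0 K1.

Definition sparse_box (a b : 'M[R]_(m, p)) : set 'M[R]_(m, p) :=
  sparse `&` [set K | forall i j, free i j -> a i j <= K i j <= b i j].

Definition box_volume (a b : 'M[R]_(m, p)) : R :=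
  \prod_(ij : 'I_m * 'I_p | free ij.1 ij.2) (b ij.1 ij.2 - a ij.1 ij.2).

(* Lebesgue outer measure zero in sparse, whose orthonormal coordinates for the
   Frobenius inner product are the free entries. Covers are indexed by a subset
   I of nat because with no free entry every box, being {0}, has volume 1. *)
Definition sparse_null (N : set 'M[R]_(m, p)) : Prop :=
  forall e : R, 0 < e ->
    exists (I : set nat) (a b : nat -> 'M[R]_(m, p)),
      [/\ forall k i j, a k i j <= b k i j,
          N `<=` \bigcup_(k in I) sparse_box (a k) (b k)
        & (\esum_(k in I) (box_volume (a k) (b k))%:E <= e%:E)%E].

End SparseCalculus.

(* Main.v *)
Require Import Defs.
From HB Require Import structures.
From mathcomp Require Import all_boot all_order all_algebra.
From mathcomp Require Import complex.
From mathcomp Require Import all_classical all_reals all_analysis.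
From mathcomp Require Import ring lra.

Set Implicit Arguments.
Unset Strict Implicit.
Unset Printing Implicit Defensive.

Import Order.TTheory GRing.Theory Num.Theory.
Import numFieldNormedType.Exports.

Local Open Scope classical_set_scope.
Local Open Scope ring_scope.

(** The key fact is that from EVERY stabilizing gain K that is not critical a
    finite path of descent steps leads to a global minimizer K*, so that the
    exceptional set consists of critical points only.

    Let T be the set of gains from which K* is reached in at least one step.
    T is relatively open.  If K is not in T and G is its gradient, no point of T
    lies in the open half-space { <G, L - K> < 0 }, hence T lies in the opposite
    open half-space (not_reaches_halfspace).  Minimize J over the part of the
    domain with <G, L - K> <= 0, at K'.  A first-order argument, a second-order
    argument at saddles, and the fact that near a strict minimizer, on the side
    away from K*, there are gains whose descent directions point to K*, all
    contradict this separation (noncritical_reaches).  Jumps of arbitrary length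
    are what makes this work: no gradient flow and no stable manifold occurs.

    The argument uses three facts about J.

    - J is a rational function on the open set of stabilizing gains
      (lqr_cost_ratfun, open_stabilizing): P(K) is the solution of a Lyapunov
      equation, a linear system with coefficients polynomial in K.  That the
      improper integral solves it rests on the decay of e^{tX} for X Hurwitz,
      which is obtained from Cayley-Hamilton (expmx_cvg0).

    - J attains its minimum on every closed set that meets the stabilizing gains
      (lqr_cost_attains_min), because a bound on J bounds P, the Lyapunov
      equation then bounds K C, and C has a right inverse.

    - The critical points form a null set (sparse_null_critical).  The local
      minimizers are strict, hence countable.  At a saddle, some entry of the
      gradient has a nonzero derivative, so near it the zeros of that entry form
      a Lipschitz graph, which is covered by boxes of small total volume
      (sparse_null_lipschitz_graph). *)

(** * Frobenius norm and positive definite matrices *)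

Section Frobenius.
Variable R : realType.

Lemma frobE m n (U V : 'M[R]_(m, n)) :
  frob U V = \sum_i \sum_j U i j * V i j.
Proof.
rewrite /frob /mxtrace exchange_big; apply: eq_bigr => j _.
by rewrite mxE; apply: eq_bigr => i _; rewrite mxE.
Qed.

Lemma frobC m n (U V : 'M[R]_(m, n)) : frob U V = frob V U.
Proof. by rewrite !frobE; do 2![apply: eq_bigr => ? _]; rewrite mulrC. Qed.

Lemma frobDr m n (U V W : 'M[R]_(m, n)) : frob U (V + W) = frob U V + frob U W.
Proof. by rewrite /frob mulmxDr raddfD. Qed.

Lemma frobNr m n (U V : 'M[R]_(m, n)) : frob U (- V) = - frob U V.
Proof. by rewrite /frob mulmxN raddfN. Qed.

Lemma frobBr m n (U V W : 'M[R]_(m, n)) : frob U (V - W) = frob U V - frob U W.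
Proof. by rewrite frobDr frobNr. Qed.

Lemma frobZr m n a (U V : 'M[R]_(m, n)) : frob U (a *: V) = a * frob U V.
Proof. by rewrite /frob -scalemxAr mxtraceZ. Qed.

Lemma frobZl m n a (U V : 'M[R]_(m, n)) : frob (a *: U) V = a * frob U V.
Proof. by rewrite frobC frobZr frobC. Qed.

Lemma frob0l m n (U : 'M[R]_(m, n)) : frob 0 U = 0.
Proof. by rewrite /frob trmx0 mul0mx mxtrace0. Qed.

Lemma frob_ge0 m n (U : 'M[R]_(m, n)) : 0 <= frob U U.
Proof. by rewrite frobE; do 2![apply: sumr_ge0 => ? _]; rewrite -expr2 sqr_ge0. Qed.

Lemma sqr_entry_le_frob m n (U : 'M[R]_(m, n)) i j : U i j ^+ 2 <= frob U U.
Proof.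
rewrite frobE (bigD1 i)//= (bigD1 j)//= -expr2 -addrA lerDl addr_ge0//.
  by apply: sumr_ge0 => ? _; rewrite -expr2 sqr_ge0.
by do 2![apply: sumr_ge0 => ? _]; rewrite -expr2 sqr_ge0.
Qed.

Lemma frob_eq0 m n (U : 'M[R]_(m, n)) : (frob U U == 0) = (U == 0).
Proof.
apply/idP/eqP => [/eqP U0|->]; last by rewrite frob0l.
apply/matrixP => i j; rewrite mxE; apply/eqP.
by rewrite -sqrf_eq0 eq_le sqr_ge0 -U0 sqr_entry_le_frob.
Qed.

Lemma frob_gt0 m n (U : 'M[R]_(m, n)) : U != 0 -> 0 < frob U U.
Proof. by move=> U0; rewrite lt_neqAle frob_ge0 eq_sym frob_eq0 U0. Qed.

Lemma frob_trmx m n (U : 'M[R]_(m, n)) : frob U^T U^T = frob U U.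
Proof.
by rewrite !frobE exchange_big; do 2![apply: eq_bigr => ? _]; rewrite !mxE.
Qed.

(** Lagrange's identity turns the defect into a sum of squares. *)
Lemma sumr_Cauchy_Schwarz (I : finType) (a b : I -> R) :
  (\sum_i a i * b i) ^+ 2 <= (\sum_i a i ^+ 2) * (\sum_i b i ^+ 2).
Proof.
rewrite -subr_ge0 -(pmulr_rge0 _ (ltr0n R 2)).
suff -> : 2 * ((\sum_i a i ^+ 2) * (\sum_i b i ^+ 2)
    - (\sum_i a i * b i) ^+ 2) = \sum_i \sum_j (a i * b j - a j * b i) ^+ 2.
  by do 2![apply: sumr_ge0 => ? _]; rewrite sqr_ge0.
transitivity (\sum_i \sum_j (a i ^+ 2 * b j ^+ 2 + a j ^+ 2 * b i ^+ 2
                            - 2 * ((a i * b i) * (a j * b j)))); last first.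
  by do 2![apply: eq_bigr => ? _]; ring.
set A := \sum_i a i ^+ 2; set B := \sum_i b i ^+ 2; set X := \sum_i a i * b i.
have -> : \sum_i \sum_j (a i ^+ 2 * b j ^+ 2 + a j ^+ 2 * b i ^+ 2
              - 2 * ((a i * b i) * (a j * b j))) =
    \sum_i (a i ^+ 2 * B + b i ^+ 2 * A - a i * b i * (2 * X)).
  apply: eq_bigr => i _; rewrite !mulr_sumr -big_split -sumrB.
  by apply: eq_bigr => j _ /=; ring.
by rewrite sumrB big_split/= -!mulr_suml -/A -/B -/X; ring.
Qed.

Lemma frob_mulmx_le m n p (U : 'M[R]_(m, n)) (V : 'M[R]_(n, p)) :
  frob (U *m V) (U *m V) <= frob U U * frob V V.
Proof.
rewrite -(frob_trmx V) !frobE mulr_suml; apply: ler_sum => i _.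
rewrite mulr_sumr; apply: ler_sum => k _.
rewrite mxE -expr2 (le_trans (sumr_Cauchy_Schwarz _ _))//.
rewrite le_eqVlt; apply/orP; left; apply/eqP; congr (_ * _).
by apply: eq_bigr => j _; rewrite mxE expr2.
Qed.

Lemma frob_abs_le m n (U V : 'M[R]_(m, n)) : 2 * frob U V <= frob U U + frob V V.
Proof.
rewrite !frobE -subr_ge0 mulr_sumr -big_split -sumrB; apply: sumr_ge0 => i _.
rewrite mulr_sumr -big_split -sumrB; apply: sumr_ge0 => j _ /=.
by have := sqr_ge0 (U i j - V i j); nra.
Qed.

End Frobenius.

Section Definite.
Variable R : realType.

(** Unlike mxE, these rules leave matrix products folded. *)
Lemma mx_linE m n : (forall (M N : 'M[R]_(m, n)) i j, (M + N) i j = M i j + N i j) *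
  (forall (M : 'M[R]_(m, n)) i j, (- M) i j = - M i j) *
  (forall c (M : 'M[R]_(m, n)) i j, (c *: M) i j = c * M i j).
Proof. by do !split=> *; rewrite mxE. Qed.

Let mx11E c : (c%:M : 'M[R]_1) 0 0 = c.
Proof. by rewrite mxE mulr1n. Qed.

Definition psdmx n (M : 'M[R]_n) : Prop :=
  forall x : 'cV[R]_n, 0 <= (x^T *m M *m x) 0 0.

Lemma posdefmx_psd n (M : 'M[R]_n) : posdefmx M -> psdmx M.
Proof.
move=> [_ Mp] x; have [->|x0] := eqVneq x 0; first by rewrite mulmx0 mxE.
exact/ltW/Mp.
Qed.

(** Eliminating one variable by completing the square leaves the Schur
    complement, which is again positive definite. *)
Lemma posdefmx_Cholesky n (S : 'M[R]_n) : posdefmx S ->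
  exists2 L : 'M[R]_n, L \in unitmx & S = L *m L^T.
Proof.
elim: n S => [|n IH] S [Ssym Spos].
  by exists 1%:M; [rewrite unitmx1|apply/matrixP => -[]].
rewrite -[n.+1]/(1 + n)%N in S Ssym Spos *.
pose a := S 0 0; pose b : 'cV[R]_n := dlsubmx S; pose S' := drsubmx S.
have ES : S = block_mx a%:M b^T b S'.
  rewrite -[LHS]submxK; congr block_mx.
    by apply/matrixP => i j; rewrite !ord1 !mxE mulr1n /a; congr (S _ _);
       apply/val_inj.
  by rewrite -[in LHS]Ssym -trmx_dlsub.
have tr11 (M : 'M[R]_1) : M^T 0 0 = M 0 0 by rewrite mxE.
have qE (x0 : R) (x : 'cV[R]_n) :
    (((col_mx x0%:M x)^T *m S *m col_mx x0%:M x) 0 0) =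
    a * x0 ^+ 2 + 2 * x0 * (b^T *m x) 0 0 + (x^T *m S' *m x) 0 0.
  have xb : (x^T *m b) 0 0 = (b^T *m x) 0 0 by rewrite -tr11 trmx_mul trmxK.
  rewrite ES tr_col_mx mul_row_block mul_row_col tr_scalar_mx.
  rewrite !mulmxDl !mul_mx_scalar !mul_scalar_mx -!scalemxAl.
  rewrite !(mx_linE, mx11E) xb; ring.
have S'sym : S'^T = S'.
  by rewrite /S' trmx_drsub Ssym.
have a0 : 0 < a.
  have := Spos (col_mx 1%:M 0); rewrite qE expr1n mulr1 !mulmx0 !mxE mulr0 !addr0.
  apply; apply/eqP => /(congr1 usubmx); rewrite col_mxKu linear0.
  by move=> /matrixP /(_ 0 0); rewrite !mxE => /eqP; rewrite oner_eq0.
have bq (x : 'cV[R]_n) : (x^T *m (b *m b^T) *m x) 0 0 = (b^T *m x) 0 0 ^+ 2.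
  rewrite !mulmxA -mulmxA mxE big_ord1.
  by rewrite -[(x^T *m b) 0 0]tr11 trmx_mul trmxK expr2.
pose T := S' - a^-1 *: (b *m b^T).
have Tpos : posdefmx T.
  split; first by rewrite /T linearB/= linearZ/= trmx_mul trmxK S'sym.
  move=> x x0.
  have := Spos (col_mx ((- a^-1 * (b^T *m x) 0 0)%:M) x).
  rewrite qE => /(_ _)/(lt_le_trans); apply.
    by apply: contra_neq x0 => /(congr1 dsubmx); rewrite col_mxKd => ->; rewrite linear0.
  rewrite /T mulmxBr mulmxBl -scalemxAr -scalemxAl.
  rewrite !mx_linE bq.
  rewrite le_eqVlt; apply/orP; left; apply/eqP; field; exact: lt0r_neq0.
have [L Lu TL] := IH T Tpos.
pose s := Num.sqrt a; have s0 : s != 0 by rewrite gt_eqF// sqrtr_gt0.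
have ss : s * s = a by rewrite -expr2 sqr_sqrtr// ltW.
exists (block_mx s%:M 0 (s^-1 *: b) L).
  rewrite unitmxE det_lblock det_scalar1 unitrM unitfE s0/=.
  by rewrite -unitmxE.
rewrite tr_block_mx mulmx_block !trmx0 !mulmx0 !mul0mx !addr0.
rewrite -TL tr_scalar_mx -scalar_mxM ss [in LHS]ES; congr block_mx.
- by rewrite linearZ/= mul_scalar_mx scalerA mulfV// scale1r.
- by rewrite mul_mx_scalar scalerA mulfV// scale1r.
- rewrite linearZ/= -scalemxAl -scalemxAr scalerA -invfM ss /T.
  by rewrite addrC subrK.
Qed.

(** With S = L L^T the trace is the squared norm of L^T N, and N is recovered
    from L^T N by the inverse of L^T. *)
Lemma posdefmx_frob_le n (S : 'M[R]_n) : posdefmx S ->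
  exists2 r : R, 0 < r & forall k (N : 'M[R]_(n, k)),
    r * frob N N <= \tr (N^T *m S *m N).
Proof.
move=> /posdefmx_Cholesky[L Lu ->].
pose c := frob (invmx L^T) (invmx L^T) + 1.
have c0 : 0 < c by rewrite ltr_wpDl// frob_ge0.
exists c^-1 => [|k N]; first by rewrite invr_gt0.
have -> : N^T *m (L *m L^T) *m N = (L^T *m N)^T *m (L^T *m N).
  by rewrite trmx_mul trmxK !mulmxA.
rewrite -/(frob _ _) ler_pdivrMl//.
rewrite -[in leLHS](mulKmx (_ : L^T \in unitmx) N) ?unitmx_tr//.
rewrite (le_trans (frob_mulmx_le _ _))// /c mulrDl mul1r lerDl frob_ge0//.
Qed.

Lemma psdmx_congr n k (M : 'M[R]_n) (N : 'M[R]_(n, k)) :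
  psdmx M -> psdmx (N^T *m M *m N).
Proof. by move=> Mp x; have := Mp (N *m x); rewrite trmx_mul !mulmxA. Qed.

Lemma psdmx_diag_ge0 n (M : 'M[R]_n) i : psdmx M -> 0 <= M i i.
Proof.
move/(_ (delta_mx i 0)); rewrite trmx_delta -rowE -colE.
by rewrite !mxE.
Qed.

Lemma qform_entry n (M : 'M[R]_n) i j :
  ((delta_mx i (0 : 'I_1))^T *m M *m delta_mx j (0 : 'I_1)) 0 0 = M i j.
Proof. by rewrite trmx_delta -rowE -colE !mxE. Qed.

(** The quadratic form at the sum and the difference of two basis vectors
    bounds an off-diagonal entry by the diagonal. *)
Lemma psdmx_entry_le_trace n (M : 'M[R]_n) i j : M^T = M -> psdmx M ->
  `|M i j| <= \tr M.
Proof.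
move=> Ms Mp.
have Mji : M j i = M i j by rewrite -[in LHS]Ms mxE.
have qE (s : R) : ((delta_mx i 0 + s *: delta_mx j 0 : 'cV[R]_n)^T *m M
    *m (delta_mx i 0 + s *: delta_mx j (0 : 'I_1))) 0 0 =
    M i i + s * M i j + s * (M i j + s * M j j).
  have -> : (delta_mx i 0 + s *: delta_mx j 0 : 'cV[R]_n)^T =
      (delta_mx i 0)^T + s *: (delta_mx j 0)^T by rewrite linearD linearZ.
  rewrite !(mulmxDl, mulmxDr) -!scalemxAl -!scalemxAr !mx_linE.
  rewrite !qform_entry Mji.
  ring.
have P1 := Mp (delta_mx i 0 + 1 *: delta_mx j 0); rewrite qE in P1.
have P2 := Mp (delta_mx i 0 + -1 *: delta_mx j 0); rewrite qE in P2.
have le_tr k : M k k <= \tr M.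
  rewrite /mxtrace (bigD1 k)//= lerDl; apply: sumr_ge0 => l _.
  exact: psdmx_diag_ge0.
have := le_tr i; have := le_tr j => Hj Hi.
rewrite ler_norml; apply/andP; split; lra.
Qed.

(** With D = L L^T, the trace of P D is that of the congruent matrix L^T P L,
    which bounds the entries of L^T P L; the congruence is then undone. *)
Lemma frob_le_sqr_trace n (D : 'M[R]_n) : posdefmx D ->
  exists2 k : R, 0 <= k & forall P : 'M[R]_n, P^T = P -> psdmx P ->
    0 <= \tr (P *m D) /\ frob P P <= k * \tr (P *m D) ^+ 2.
Proof.
move=> /posdefmx_Cholesky[L Lu ->].
pose c := frob (invmx L) (invmx L).
have c0 : 0 <= c by exact: frob_ge0.
exists (c * (n%:R * n%:R) * c) => [|P Ps Pp].
  by rewrite !mulr_ge0.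
pose G := L^T *m P *m L.
have GE : (invmx L)^T *m G *m invmx L = P.
  rewrite /G !mulmxA -trmx_mul mulmxV// trmx1 mul1mx -mulmxA mulmxV//.
  by rewrite mulmx1.
have Gt : \tr G = \tr (P *m (L *m L^T)).
  by rewrite /G -mulmxA mxtrace_mulC mulmxA.
have Gs : G^T = G by rewrite /G !trmx_mul trmxK Ps mulmxA.
have Gp : psdmx G by exact: psdmx_congr.
have GG : frob G G <= n%:R * n%:R * \tr G ^+ 2.
  have -> : n%:R * n%:R * \tr G ^+ 2 = \sum_(i < n) \sum_(j < n) \tr G ^+ 2.
    under eq_bigr do rewrite sumr_const card_ord -mulr_natl.
    by rewrite sumr_const card_ord -[RHS]mulr_natl mulrA.
  rewrite frobE; apply: ler_sum => i _; apply: ler_sum => j _.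
  rewrite -expr2 -real_normK ?num_real// lerXn2r// ?nnegrE.
    exact: le_trans (psdmx_entry_le_trace i j Gs Gp).
  exact: psdmx_entry_le_trace.
split; first by rewrite -Gt sumr_ge0// => i _; exact: psdmx_diag_ge0.
clearbody G; rewrite -Gt -GE; apply: le_trans (frob_mulmx_le _ _) _.
have -> : c * (n%:R * n%:R) * c * \tr G ^+ 2 =
    c * (n%:R * n%:R * \tr G ^+ 2) * c by ring.
rewrite -/c ler_wpM2r// (le_trans (frob_mulmx_le _ _))// frob_trmx -/c.
by rewrite ler_wpM2l.
Qed.

End Definite.

(** * The matrix exponential *)

Section EntrywiseLimits.
Variable R : realType.

Lemma cvg_mx_entries (T : Type) (F : set_system T) {FF : Filter F} m n
    (u : T -> 'M[R]_(m, n)) (l : 'M[R]_(m, n)) :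
  (forall i j, u x i j @[x --> F] --> l i j) -> u x @[x --> F] --> l.
Proof.
move=> ul; apply/cvgrPdist_le => e e0.
have : \forall x \near F, forall ij : 'I_m * 'I_n,
    `|l ij.1 ij.2 - u x ij.1 ij.2| <= e.
  by apply: filter_forall => -[i j] /=; move/cvgrPdist_le: (ul i j); apply.
apply: filterS => x Hx.
rewrite /Num.Def.normr/= mx_normrE (bigmax_le _ (ltW e0))//= => ij _.
by rewrite !mxE; exact: Hx.
Qed.

End EntrywiseLimits.

Section Exponential.
Variables (R : realType) (n : nat).
Implicit Types X Y : 'M[R]_n.

(** Differentiating the power series in t of an entry of Y e^{tX} gives that
    of Y X e^{tX}; the left factor Y closes the family under differentiation. *)
Definition expmx_coef Y X (i j : 'I_n) (k : nat) : R :=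
  (k`!%:R)^-1 * (Y *m X ^+ k) i j.

Lemma exprmxZ (t : R) X k : (t *: X) ^+ k = t ^+ k *: X ^+ k.
Proof.
elim: k => [|k IH]; first by rewrite !expr0 scale1r.
by rewrite !exprS IH -!mulmxE -scalemxAl -scalemxAr scalerA.
Qed.

Lemma frob_exprmx_le X k : frob (X ^+ k) (X ^+ k) <= n%:R * frob X X ^+ k.
Proof.
elim: k => [|k IH].
  rewrite expr0 mulr1 /frob trmx1 mul1mx mxtrace1.
  by rewrite lexx.
rewrite exprS -mulmxE (le_trans (frob_mulmx_le _ _))//.
by rewrite exprS mulrCA ler_wpM2l// frob_ge0.
Qed.

(** The coefficients are dominated by those of a scalar exponential, because the
    entries of Y X^k grow at most geometrically. *)
Lemma expmx_coef_summable Y X i j (t : R) :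
  cvgn (pseries (expmx_coef Y X i j) t).
Proof.
pose c := frob X X + 1; pose b := frob Y Y * n%:R + 1.
have X0 := frob_ge0 X; have Y0 := frob_ge0 Y.
have c1 : 1 <= c by rewrite lerDr.
have b1 : 1 <= b by rewrite lerDr mulr_ge0.
have c0 : 0 <= c by rewrite (le_trans _ c1).
have b0 : 0 <= b by rewrite (le_trans _ b1).
have bnd k : `|(Y *m X ^+ k) i j| <= b * c ^+ k.
  have bc0 : 0 <= b * c ^+ k by rewrite mulr_ge0// exprn_ge0.
  rewrite -(ler_pXn2r (ltn0Sn 1)) ?nnegrE// real_normK ?num_real//.
  rewrite (le_trans (sqr_entry_le_frob _ _ _))//.
  rewrite (le_trans (frob_mulmx_le _ _))//.
  apply: (@le_trans _ _ (b * c ^+ k)).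
    rewrite (@le_trans _ _ (frob Y Y * (n%:R * frob X X ^+ k)))//.
      by rewrite ler_wpM2l// frob_exprmx_le.
    rewrite mulrA ler_pM ?mulr_ge0 ?exprn_ge0//; first by rewrite lerDl.
    by rewrite lerXn2r ?nnegrE// lerDl.
  by rewrite expr2 ler_peMr// mulr_ege1// exprn_ege1.
apply: normed_cvg; rewrite /normed_series_of /=.
apply: (@series_le_cvg _ _ (fun k => b * exp_coeff (c * `|t|) k)).
- by move=> k.
- by move=> k; rewrite mulr_ge0// exp_coeff_ge0// mulr_ge0.
- move=> k; rewrite /expmx_coef /exp_coeff /= !normrM normfV normr_nat normrX.
  rewrite exprMn (_ : b * _ = (k`!%:R)^-1 * (b * c ^+ k) * `|t| ^+ k); last ring.
  by rewrite ler_wpM2r ?exprn_ge0// ler_wpM2l// invr_ge0.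
- exact/is_cvg_seriesZ/is_cvg_series_exp_coeff.
Qed.

Lemma mulmx_expmxE Y X (t : R) i j :
  (Y *m expmx (t *: X)) i j = limn (pseries (expmx_coef Y X i j) t).
Proof.
pose u := series (fun k : nat => (k`!%:R : R)^-1 *: (t *: X) ^+ k).
have uE (Z : 'M[R]_n) i' j' N :
    (Z *m u N) i' j' = pseries (expmx_coef Z X i' j') t N.
  rewrite /u /pseries /series/= mulmx_sumr summxE; apply: eq_bigr => k _.
  rewrite exprmxZ scalerA -scalemxAr mxE /expmx_coef; ring.
have u_cvg : u N @[N --> \oo] --> expmx (t *: X).
  suff u_l : u N @[N --> \oo] -->
      \matrix_(i, j) limn (pseries (expmx_coef 1%:M X i j) t).
    suff -> : expmx (t *: X) = \matrix_(i, j)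
        limn (pseries (expmx_coef 1%:M X i j) t) by [].
    by apply: cvg_lim u_l; exact: norm_hausdorff.
  apply: cvg_mx_entries => i' j'; rewrite mxE.
  under eq_cvg do rewrite -(mul1mx (u _)) uE.
  exact: expmx_coef_summable.
apply/esym/cvg_lim => //.
rewrite (_ : pseries _ t = fun N => \sum_k Y i k * u N k j); last first.
  by apply/funext => N; rewrite -uE mxE.
rewrite mxE; apply: cvg_big => [|k _]; first exact: add_continuous.
apply: cvgMr; exact: (cvg_comp _ _ u_cvg (@coord_continuous _ _ _ _ _ _)).
Qed.

Lemma is_derive_expmx Y X (t : R) i j :
  is_derive t 1 (fun s => (Y *m expmx (s *: X)) i j)
    ((Y *m X *m expmx (t *: X)) i j).
Proof.
have diffsE Z : pseries_diffs (expmx_coef Z X i j) = expmx_coef (Z *m X) X i j.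
  apply/funext => k; rewrite /pseries_diffs /expmx_coef factS natrM invfM.
  by rewrite exprS -mulmxE mulrA mulVKf ?pnatr_eq0// mulmxA.
rewrite mulmx_expmxE.
under eq_fun do rewrite mulmx_expmxE.
rewrite -diffsE; apply: (@pseries_snd_diffs _ _ (`|t| + 1)).
- exact: expmx_coef_summable.
- by rewrite diffsE; exact: expmx_coef_summable.
- by rewrite !diffsE; exact: expmx_coef_summable.
- by rewrite [ltRHS]ger0_norm ?addr_ge0// ltrDl.
Qed.

Lemma expmx0 : expmx (0 : 'M[R]_n) = 1%:M.
Proof.
apply/matrixP => i j; rewrite -(mul1mx (expmx _)) -(scale0r 0) mulmx_expmxE.
apply: cvg_lim => //; rewrite -(cvg_shiftn 1).
rewrite (_ : (fun k => _) = cst ((1%:M : 'M[R]_n) i j)); first exact: cvg_cst.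
apply/funext => k; rewrite /pseries /series/= addn1 big_nat_recl//.
rewrite big1 ?addr0 => [|l _]; last by rewrite expr0n mulr0.
by rewrite /expmx_coef !expr0 mulr1 invr1 mul1r mulmx1.
Qed.

Lemma expmx_trmx X (t : R) : expmx (t *: X^T) = (expmx (t *: X))^T.
Proof.
apply/matrixP => i j; rewrite mxE -(mul1mx (expmx _)) -[in RHS](mul1mx (expmx _)).
rewrite !mulmx_expmxE; congr (limn (pseries _ t)).
apply/funext => k; rewrite /expmx_coef !mul1mx; congr (_ * _).
suff -> : X^T ^+ k = (X ^+ k)^T by rewrite mxE.
elim: k => [|k IH]; first by rewrite !expr0 trmx1.
by rewrite exprSr IH exprS -!mulmxE trmx_mul.
Qed.

End Exponential.

(** * Decay of the exponential of a Hurwitz matrix *)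

Section ComplexParts.
Variable R : realType.
Local Notation Remx := (map_mx (@complex.Re R)).
Local Notation Immx := (map_mx (@complex.Im R)).

Lemma complex_ReD (x y : R[i]) : complex.Re (x + y) = complex.Re x + complex.Re y.
Proof. by case: x; case: y. Qed.

Lemma complex_ImD (x y : R[i]) : complex.Im (x + y) = complex.Im x + complex.Im y.
Proof. by case: x; case: y. Qed.

Lemma Remx_mul_real m n p (M : 'M[R[i]]_(m, n)) (X : 'M[R]_(n, p)) :
  Remx (M *m map_mx (real_complex R) X) = Remx M *m X.
Proof.
apply/matrixP => i j; rewrite !mxE (big_morph _ complex_ReD (erefl _)).
by apply: eq_bigr => k _; rewrite !mxE; case: (M i k) => a b /=; rewrite mulr0 subr0.
Qed.

Lemma Immx_mul_real m n p (M : 'M[R[i]]_(m, n)) (X : 'M[R]_(n, p)) :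
  Immx (M *m map_mx (real_complex R) X) = Immx M *m X.
Proof.
apply/matrixP => i j; rewrite !mxE (big_morph _ complex_ImD (erefl _)).
by apply: eq_bigr => k _; rewrite !mxE; case: (M i k) => a b /=; rewrite mulr0 add0r.
Qed.

Lemma Remx_scale m n (z : R[i]) (M : 'M[R[i]]_(m, n)) :
  Remx (z *: M) = complex.Re z *: Remx M - complex.Im z *: Immx M.
Proof. by apply/matrixP => i j; rewrite !mxE; case: z; case: (M i j). Qed.

Lemma Immx_scale m n (z : R[i]) (M : 'M[R[i]]_(m, n)) :
  Immx (z *: M) = complex.Re z *: Immx M + complex.Im z *: Remx M.
Proof.
by apply/matrixP => i j; rewrite !mxE; case: z; case: (M i j) => a b c d /=.
Qed.

Lemma RemxD m n (M N : 'M[R[i]]_(m, n)) : Remx (M + N) = Remx M + Remx N.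
Proof. by apply/matrixP => i j; rewrite !mxE complex_ReD. Qed.

Lemma ImmxD m n (M N : 'M[R[i]]_(m, n)) : Immx (M + N) = Immx M + Immx N.
Proof. by apply/matrixP => i j; rewrite !mxE complex_ImD. Qed.

End ComplexParts.

Section Decay.
Variable R : realType.

(** Beyond a time after which w <= a e, the function e^{at} (v - e) is
    nonincreasing, so v is eventually below 2 e. *)
Lemma cvg0_of_derive_le (v w dv : R -> R) (a : R) : 0 < a ->
  (forall t, 0 <= v t) -> (forall t : R, is_derive t 1 v (dv t)) ->
  (forall t, dv t <= - a * v t + w t) ->
  w t @[t --> +oo] --> 0 -> v t @[t --> +oo] --> 0.
Proof.
move=> a0 v0 dvE dv_le /cvgrPdist_le w0; apply/cvgrPdist_le => e e0.
pose e' := e / 2; have e'0 : 0 < e' by rewrite divr_gt0.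
have [T [_ HT]] := w0 _ (mulr_gt0 a0 e'0).
pose z t := expR (a * t) * (v t - e').
have dz (t : R) : is_derive t 1 z (expR (a * t) * dv t + (v t - e') * (expR (a * t) * a)).
  have dlin : is_derive t 1 (fun s : R => a * s) a.
    have -> : (fun s : R => a * s) = a \*: id by [].
    by apply: is_derive_eq; rewrite /GRing.scale/= mulr1.
  have de : is_derive t 1 (fun s => expR (a * s)) (expR (a * t) * a).
    exact: (is_derive1_comp (is_derive_expR _) dlin).
  have dv' : is_derive t 1 (fun s => v s - e') (dv t).
    have -> : (fun s => v s - e') = v - cst e' by [].
    by apply: is_derive_eq; rewrite subr0.
  exact: (is_deriveM de dv').
pose T' := T + 1.
have zdecr x : T' <= x -> z x <= z T'.
  apply: ler0_derive1_nincry => [t _|t||//].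
  - by case: (dz t).
  - rewrite in_itv/= andbT derive1E => tT; rewrite (@derive_val _ _ _ _ _ _ _ (dz t)).
    rewrite mulrCA -mulrDr pmulr_rle0 ?expR_gt0//.
    have := HT t; rewrite sub0r normrN => /(_ _)/ler_normlP[|_ wt].
      by rewrite (lt_trans _ tT)// ltrDl.
    have := dv_le t; nra.
  - apply: derivable_within_continuous => t _; by case: (dz t).
exists (Num.max T' (`|z T'| / (a * e'))); split; first exact: num_real.
move=> t; rewrite gt_max => /andP[T't zt].
have := zdecr _ (ltW T't); rewrite /z -/(z T') => zt'.
rewrite sub0r normrN ger0_norm//.
suff : v t - e' <= e' by rewrite /e'; lra.
rewrite -(ler_pM2l (expR_gt0 (a * t))).
rewrite (le_trans zt')// (le_trans (ler_norm _))//.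
rewrite -ler_pdivrMr// (le_trans _ (expR_ge1Dx _))//.
rewrite ler_wpDl// ltW// [ltRHS]mulrC -ltr_pdivrMr//.
by rewrite -mulrA -invfM [e' * a]mulrC.
Qed.

(** The pair (y1, y2) is a complex function with y' = z y + u for
    z = al + i be; its squared modulus obeys the scalar inequality above. *)
Lemma cvg0_of_complex_ode (y1 y2 u1 u2 : R -> R) (al be : R) : al < 0 ->
  (forall t : R, is_derive t 1 y1 (al * y1 t - be * y2 t + u1 t)) ->
  (forall t : R, is_derive t 1 y2 (al * y2 t + be * y1 t + u2 t)) ->
  u1 t @[t --> +oo] --> 0 -> u2 t @[t --> +oo] --> 0 ->
  y1 t @[t --> +oo] --> 0 /\ y2 t @[t --> +oo] --> 0.
Proof.
move=> al0 d1 d2 u10 u20.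
pose v t := y1 t ^+ 2 + y2 t ^+ 2.
have v0 t : 0 <= v t by rewrite addr_ge0 ?sqr_ge0.
have dv (t : R) : is_derive t 1 v (2 * y1 t * (al * y1 t - be * y2 t + u1 t)
                           + 2 * y2 t * (al * y2 t + be * y1 t + u2 t)).
  have -> : v = y1 * y1 + y2 * y2 by apply/funext => s; rewrite /v !expr2.
  apply: is_derive_eq (is_deriveD (is_deriveM (d1 t) (d1 t))
                                  (is_deriveM (d2 t) (d2 t))) _; rewrite /GRing.scale/=; ring.
have vlim : v t @[t --> +oo] --> 0.
  pose w t := (- al)^-1 * (u1 t * u1 t + u2 t * u2 t).
  have al0' : 0 < - al by rewrite oppr_gt0.
  apply: (cvg0_of_derive_le (w := w) al0' v0 dv).
  - move=> t; rewrite /v /w -subr_ge0.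
    have al1 : al != 0 by rewrite lt_eqF.
    rewrite (_ : _ - _ = (- al)^-1 * ((al * y1 t + u1 t) ^+ 2
                          + (al * y2 t + u2 t) ^+ 2)); last first.
      by field.
    by rewrite mulr_ge0 ?addr_ge0 ?sqr_ge0// invr_ge0 oppr_ge0 ltW.
  - have -> : (0 : R) = (- al)^-1 * (0 * 0 + 0 * 0) by rewrite mulr0 addr0 mulr0.
    by apply: cvgMr; apply: cvgD; apply: cvgM.
have small (y : R -> R) : (forall t, y t ^+ 2 <= v t) -> y t @[t --> +oo] --> 0.
  move=> yv; apply/cvgrPdist_le => e e0; move/cvgrPdist_le: vlim.
  move=> /(_ _ (exprn_gt0 2 e0)); apply: filterS => t.
  rewrite !sub0r !normrN (ger0_norm (v0 t)) => vt.
  rewrite -(ler_pXn2r (ltn0Sn 1)) ?nnegrE// ?(ltW e0)// real_normK ?num_real//.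
  exact: le_trans vt.
by split; apply: small => t; rewrite /v ?lerDl ?lerDr sqr_ge0.
Qed.

Lemma is_derive_sum_fun n (h : 'I_n -> R -> R) (dh : 'I_n -> R) (t : R) :
  (forall i, is_derive t 1 (h i) (dh i)) ->
  is_derive t 1 (fun s => \sum_i h i s) (\sum_i dh i).
Proof.
move=> H; have -> : (fun s => \sum_i h i s) = \sum_i h i.
  by apply/funext => s; rewrite fct_sumE.
exact: is_derive_sum.
Qed.

Lemma cvg_sum_fun (T : Type) (F : set_system T) {FF : Filter F} n
    (h : 'I_n -> T -> R) (l : 'I_n -> R) :
  (forall i, h i x @[x --> F] --> l i) ->
  \sum_i h i x @[x --> F] --> \sum_i l i.
Proof. by move=> H; apply: cvg_big => [|k _]; [exact: add_continuous|exact: H]. Qed.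

Lemma cvg0_sum_fun (T : Type) (F : set_system T) {FF : Filter F} n
    (h : 'I_n -> T -> R) :
  (forall i, h i x @[x --> F] --> 0) -> \sum_i h i x @[x --> F] --> 0.
Proof.
by move=> /cvg_sum_fun; rewrite big1.
Qed.

(** With the eigenvalues z_1, ..., z_n listed in r, Cayley-Hamilton says that
    the product M_n of all X - z_k vanishes.  The partial products satisfy
    (M_k e^{tX})' = z (M_k e^{tX}) + M_{k+1} e^{tX}, with z the next eigenvalue,
    so decay propagates from M_n = 0 down to M_0 = 1. *)
Lemma expmx_cvg0 n (X : 'M[R]_n) i j : hurwitz X ->
  (expmx (t *: X)) i j @[t --> +oo] --> 0.
Proof.
case: n => [|n] in X i j *; first by case: i.
move=> hX; pose XC : 'M[R[i]]_n.+1 := map_mx (real_complex R) X.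
pose decays (M : 'M[R[i]]_n.+1) := forall i j,
  (map_mx (@complex.Re R) M *m expmx (t *: X)) i j @[t --> +oo] --> 0 /\
  (map_mx (@complex.Im R) M *m expmx (t *: X)) i j @[t --> +oo] --> 0.
have step z M : eigenvalue XC z -> decays (M * (XC - z%:M)) -> decays M.
  move=> /hX z0 dM k l; have [] := dM k l.
  set M' := M * _; pose P := map_mx (@complex.Re R) M.
  pose Q := map_mx (@complex.Im R) M.
  pose U := map_mx (@complex.Re R) M'; pose V := map_mx (@complex.Im R) M'.
  have MX : M *m XC = z *: M + M'.
    by rewrite /M' mulrBr -mulmxE mul_mx_scalar addrC subrK.
  have PX : P *m X = complex.Re z *: P - complex.Im z *: Q + U.
    by rewrite -Remx_mul_real MX RemxD Remx_scale.
  have QX : Q *m X = complex.Re z *: Q + complex.Im z *: P + V.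
    by rewrite -Immx_mul_real MX ImmxD Immx_scale.
  apply: cvg0_of_complex_ode z0 _ _ => t.
    have := is_derive_expmx P X t k l; rewrite PX => H; apply: is_derive_eq H _.
    by rewrite !mulmxDl mulNmx -!scalemxAl !mx_linE.
  have := is_derive_expmx Q X t k l; rewrite QX => H; apply: is_derive_eq H _.
  by rewrite !mulmxDl -!scalemxAl !mx_linE.
have [r rE] := closed_field_poly_normal (char_poly XC).
have {}rE : char_poly XC = \prod_(z <- r) ('X - z%:P).
  by rewrite {1}rE (monicP (char_poly_monic XC)) scale1r.
have prod0 : \prod_(z <- r) (XC - z%:M) = 0.
  rewrite -(Cayley_Hamilton XC) rE rmorph_prod; apply: eq_bigr => z _.
  by rewrite rmorphB /= horner_mx_X horner_mx_C.
have r_eig z : z \in r -> eigenvalue XC z.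
  by move=> zr; rewrite eigenvalue_root_char rE root_prod_XsubC.
have decays1 : decays 1.
  suff H s : {subset s <= r} -> forall M, decays (M * \prod_(z <- s) (XC - z%:M)) ->
      decays M.
    apply: (H r) => // k l; rewrite prod0 mulr0.
    have E0 (f : R[i] -> R) : f 0 = 0 -> map_mx f (0 : 'M[R[i]]_n.+1) = 0.
      by move=> f0; apply/matrixP => ? ?; rewrite !mxE.
    rewrite !E0// (_ : (fun t : R => (0 *m expmx (t *: X)) k l) = cst 0).
      by split; exact: cvg_cst.
    by apply/funext => t; rewrite mul0mx mxE.
  elim: s => [_ M|z s IH sr M]; first by rewrite big_nil mulr1.
  rewrite big_cons mulrA => /IH dM; apply: (step z).
    by apply: r_eig; apply: sr; rewrite mem_head.
  by apply: dM => y ys; apply: sr; rewrite in_cons ys orbT.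
have [+ _] := decays1 i j.
suff -> : map_mx (@complex.Re R) (1 : 'M[R[i]]_n.+1) = 1%:M.
  by under eq_cvg do rewrite mul1mx.
by apply/matrixP => k l; rewrite !mxE; case: (k == l).
Qed.

End Decay.

(** * The Lyapunov equation *)

Section Lyapunov.
Variables (R : realType) (n : nat).
Implicit Types X P W : 'M[R]_n.

Let entry_trmx m q (M : 'M[R]_(m, q)) i j : M i j = M^T j i.
Proof. by rewrite mxE. Qed.

Definition lyapunov X P : 'M[R]_n := X^T *m P + P *m X.

Lemma lyapunovB X P Q : lyapunov X (P - Q) = lyapunov X P - lyapunov X Q.
Proof. by rewrite /lyapunov mulmxBr mulmxBl opprD addrACA. Qed.

Lemma lyapunov_trmx X P : lyapunov X P^T = (lyapunov X P)^T.
Proof. by rewrite /lyapunov linearD/= !trmx_mul trmxK addrC. Qed.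

Definition expmx_congr X P (t : R) : 'M[R]_n :=
  (expmx (t *: X))^T *m P *m expmx (t *: X).

Lemma expmx_congr0 X P : expmx_congr X P 0 = P.
Proof. by rewrite /expmx_congr scale0r expmx0 trmx1 mul1mx mulmx1. Qed.

Lemma expmx_congrE X P (t : R) i j : expmx_congr X P t i j =
  \sum_k (P^T *m expmx (t *: X)) k i * (1%:M *m expmx (t *: X)) k j.
Proof.
rewrite mxE; apply: eq_bigr => k _; rewrite mul1mx; congr (_ * _).
by rewrite [RHS]entry_trmx trmx_mul trmxK.
Qed.

Lemma is_derive_expmx_congr X P (t : R) i j :
  is_derive t 1 (fun s => expmx_congr X P s i j)
    (expmx_congr X (lyapunov X P) t i j).
Proof.
under eq_fun do rewrite expmx_congrE.
have H k := is_deriveM (is_derive_expmx P^T X t k i) (is_derive_expmx 1%:M X t k j).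
apply: is_derive_eq (is_derive_sum_fun H) _.
rewrite /GRing.scale/= big_split/= addrC.
rewrite /lyapunov /expmx_congr mulmxDr mulmxDl [RHS]mxE; congr (_ + _).
  rewrite mulmxA -trmx_mul mxE; apply: eq_bigr => k _.
  rewrite mulrC mul1mx; congr (_ * _).
  by rewrite [LHS]entry_trmx !trmx_mul trmxK mulmxA.
rewrite mulmxA -[in RHS]mulmxA [RHS]mxE; apply: eq_bigr => k _; rewrite mul1mx.
by congr (_ * _); rewrite [LHS]entry_trmx trmx_mul trmxK.
Qed.

Lemma expmx_congr_cvg0 X P i j : hurwitz X ->
  expmx_congr X P t i j @[t --> +oo] --> 0.
Proof.
move=> hX; under eq_cvg do rewrite expmx_congrE.
have E0 Y k l : (Y *m expmx (t *: X)) k l @[t --> +oo] --> 0.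
  under eq_cvg do rewrite mxE.
  apply: (@cvg0_sum_fun R R (pinfty_nbhs R)) => q; rewrite -(mulr0 (Y k q)).
  by apply: cvgMr; exact: expmx_cvg0.
apply: (@cvg0_sum_fun R R (pinfty_nbhs R)) => k; rewrite -(mulr0 0).
by apply: cvgM; exact: E0.
Qed.

(** If X^T P + P X = 0, then (e^{tX})^T P e^{tX} is constant in t, and it tends
    to 0. *)
Lemma lyapunov_eq0 X P : hurwitz X -> lyapunov X P = 0 -> P = 0.
Proof.
move=> hX P0; apply/matrixP => i j; rewrite [RHS]mxE.
have cst_F t : expmx_congr X P t i j = P i j.
  rewrite -[in RHS](expmx_congr0 X P).
  apply: (is_derive_0_is_cst (f := fun s => expmx_congr X P s i j)) => s.
  apply: is_derive_eq (is_derive_expmx_congr X P s i j) _.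
  by rewrite P0 /expmx_congr mulmx0 mul0mx mxE.
have := expmx_congr_cvg0 P i j hX.
under eq_cvg do rewrite cst_F.
move=> H; exact: (cvg_unique _ (cvg_cst _) H).
Qed.

Lemma lyapunov_inj X P Q : hurwitz X -> lyapunov X P = lyapunov X Q -> P = Q.
Proof.
move=> hX PQ; apply/eqP; rewrite -subr_eq0; apply/eqP.
by apply: lyapunov_eq0 hX _; rewrite lyapunovB PQ subrr.
Qed.

Lemma continuous_expmx_congr X P i j :
  continuous (fun t : R => expmx_congr X P t i j).
Proof.
move=> t; apply: differentiable_continuous; apply/derivable1_diffP.
by case: (is_derive_expmx_congr X P t i j).
Qed.

End Lyapunov.

Section ImproperIntegral.
Variable R : realType.
Local Notation mu := (@lebesgue_measure R).

Lemma ge0_Rintegral_derivative (f F : R -> R) :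
  (forall t, (0 : R) <= f t) -> continuous f ->
  (forall t : R, is_derive t 1 F (- f t)) -> F t @[t --> +oo] --> 0 ->
  mu.-integrable `[0%R, +oo[ (EFin \o f) /\ Rintegral mu `[0%R, +oo[ f = F 0.
Proof.
move=> f0 cf dF F0.
have dNF (t : R) : is_derive t 1 (- F) (f t).
  by apply: is_derive_eq; rewrite opprK.
have cF : continuous F.
  move=> t; apply: differentiable_continuous; apply/derivable1_diffP.
  by case: (dF t).
have intE : (\int[mu]_(x in `[0%R, +oo[) (f x)%:E = (F 0%R)%:E)%E.
  rewrite (@ge0_continuous_FTC2y _ f (- F) 0 0).
  - by rewrite -EFinB sub0r opprfctE opprK.
  - by move=> x _.
  - exact: continuous_subspaceT.
  - by rewrite -(oppr0 R); exact: cvgN.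
  - by move=> x _; case: (dNF x).
  - by apply: cvg_at_right_filter; apply: cvgN; exact: cF.
  - by move=> x _; rewrite derive1E; case: (dNF x).
split; last by rewrite /Rintegral intE.
apply/integrableP; split.
  apply/measurable_realfun.measurable_EFinP/measurable_funTS.
  exact: measurable_realfun.continuous_measurable_fun.
under eq_integral do rewrite /= ger0_norm//.
by rewrite intE ltry.
Qed.

End ImproperIntegral.

Section LyapunovStability.
Variable R : realType.

Lemma trmx_char_poly (F : fieldType) n (M : 'M[F]_n) :
  char_poly M^T = char_poly M.
Proof.
rewrite /char_poly -[in RHS]det_tr; congr (\det _).
by apply/matrixP => i j; rewrite !mxE eq_sym.
Qed.

(** The form x^T (e^{tX})^T P e^{tX} x is nonincreasing in t and tends to 0, so
    its value at t = 0 is nonnegative. *)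
Lemma lyapunov_psd n (X P W : 'M[R]_n) : hurwitz X -> psdmx W ->
  lyapunov X P = - W -> psdmx P.
Proof.
move=> hX W0 PW x.
pose F t := \sum_k (x^T *m expmx_congr X P t) 0 k * x k 0.
pose dF t := \sum_k (x^T *m expmx_congr X (- W) t) 0 k * x k 0.
have FE Q t : \sum_k (x^T *m expmx_congr X Q t) 0 k * x k 0 =
  (x^T *m expmx_congr X Q t *m x) 0 0 by rewrite [RHS]mxE.
have dFE (t : R) : is_derive t 1 F (dF t).
  apply: is_derive_sum_fun => k.
  have dk : is_derive t 1 (fun s => (x^T *m expmx_congr X P s) 0 k)
      ((x^T *m expmx_congr X (- W) t) 0 k).
    rewrite mxE; under eq_fun do rewrite mxE.
    apply: is_derive_sum_fun => l; rewrite -PW.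
    exact: is_deriveZ (is_derive_expmx_congr X P t l k).
  have -> : (fun s => (x^T *m expmx_congr X P s) 0 k * x k 0) =
            x k 0 \*: (fun s => (x^T *m expmx_congr X P s) 0 k).
    by apply/funext => s; rewrite /= mulrC.
  by apply: is_derive_eq; rewrite /GRing.scale/= mulrC.
have dF_le0 t : dF t <= 0.
  rewrite /dF FE /expmx_congr mulmxN mulNmx mulmxN mulNmx mx_linE oppr_le0.
  by have := W0 (expmx (t *: X) *m x); rewrite trmx_mul !mulmxA.
have Flim : F t @[t --> +oo] --> 0.
  apply: (@cvg0_sum_fun R R (pinfty_nbhs R)) => k; rewrite -(mul0r (x k 0)).
  apply: cvgMl; under eq_cvg do rewrite mxE.
  apply: (@cvg0_sum_fun R R (pinfty_nbhs R)) => l; rewrite -(mulr0 (x^T 0 l)).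
  by apply: cvgMr; exact: expmx_congr_cvg0.
have F0 : F 0 = (x^T *m P *m x) 0 0 by rewrite /F FE expmx_congr0.
rewrite -F0 leNgt; apply/negP => F00.
have Fdecr t : 0 <= t -> F t <= F 0.
  move=> t0; apply: (@ler0_derive1_nincry _ F 0) => [s _|s _|||//].
  - by case: (dFE s).
  - by rewrite derive1E; have [_ ->] := dFE s; exact: dF_le0.
  - by apply: derivable_within_continuous => s _; case: (dFE s).
  - exact: lexx.
have NF0 : 0 < - F 0 by rewrite oppr_gt0.
have : \forall t \near +oo, `|0 - F t| < - F 0.
  by move/cvgrPdist_lt: Flim; apply.
have : \forall t \near +oo, (0 : R) <= t by exact: nbhs_pinfty_ge.
move=> near0 nearF.
have [t [t0 Ft]] : exists t, 0 <= t /\ `|0 - F t| < - F 0.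
  by apply: (@filter_ex _ (pinfty_nbhs R)); apply: filterI.
move: Ft; rewrite sub0r normrN ltNge => /negP; apply.
have Ft := Fdecr t t0.
by rewrite (ler0_norm (le_trans Ft (ltW F00))) lerN2.
Qed.

(** An eigenvector x + i y of X for z contributes
    2 Re(z) (x^T P x + y^T P y) = - (x^T W x + y^T W y) < 0. *)
Lemma hurwitz_of_lyapunov n (X P W : 'M[R]_n) : P^T = P -> psdmx P ->
  posdefmx W -> lyapunov X P = - W -> hurwitz X.
Proof.
move=> Ps Pp Wp PW z zX.
have : eigenvalue (map_mx (real_complex R) X^T) z.
  by rewrite eigenvalue_root_char -matrix.map_trmx trmx_char_poly -eigenvalue_root_char.
move=> /eigenvalueP[v vX v0].
pose x := (map_mx (@complex.Re R) v)^T; pose y := (map_mx (@complex.Im R) v)^T.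
have Xx : X *m x = complex.Re z *: x - complex.Im z *: y.
  apply: trmx_inj; rewrite trmx_mul trmxK -Remx_mul_real vX Remx_scale.
  by rewrite linearB/= !linearZ/= !trmxK.
have Xy : X *m y = complex.Re z *: y + complex.Im z *: x.
  apply: trmx_inj; rewrite trmx_mul trmxK -Immx_mul_real vX Immx_scale.
  by rewrite linearD/= !linearZ/= !trmxK.
have Wsum : 0 < (x^T *m W *m x) 0 0 + (y^T *m W *m y) 0 0.
  have [x0|x0] := eqVneq x 0; last first.
    by rewrite ltr_wpDr ?(posdefmx_psd Wp)//; apply: Wp.2.
  have [y0|y0] := eqVneq y 0; last first.
    by rewrite ltr_wpDl ?(posdefmx_psd Wp)//; apply: Wp.2.
  case/eqP: v0; apply/matrixP => i j; rewrite [RHS]mxE.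
  have := congr1 (fun M : 'cV_n => M j i) x0.
  have := congr1 (fun M : 'cV_n => M j i) y0.
  by rewrite !mxE; case: (v i j) => a b /= -> ->.
have WE (u : 'cV[R]_n) : (u^T *m W *m u) 0 0 = - 2 * (u^T *m P *m (X *m u)) 0 0.
  have -> : W = - lyapunov X P by rewrite PW opprK.
  rewrite /lyapunov mulmxN mulNmx mulmxDr mulmxDl !mx_linE.
  have -> : (u^T *m (X^T *m P) *m u) 0 0 = (u^T *m P *m (X *m u)) 0 0.
    have tr11 (M : 'M[R]_1) : M 0 0 = M^T 0 0 by rewrite mxE.
    by rewrite [LHS]tr11 !trmx_mul !trmxK Ps !mulmxA.
  by rewrite !mulmxA; ring.
have Pxy : (y^T *m P *m x) 0 0 = (x^T *m P *m y) 0 0.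
  have tr11 (M : 'M[R]_1) : M 0 0 = M^T 0 0 by rewrite mxE.
  by rewrite [LHS]tr11 !trmx_mul !trmxK Ps !mulmxA.
move: Wsum; rewrite !WE Xx Xy mulmxBr mulmxDr -!scalemxAr !mx_linE Pxy.
by have := Pp x; have := Pp y; nra.
Qed.

(** The integrand is minus the derivative of (e^{tX})^T P e^{tX}.  An entry of a
    positive semidefinite matrix becomes nonnegative when the trace is added to
    it, so both the sum and the trace are integrable, being nonnegative
    derivatives of convergent functions. *)
Lemma Rintegral_expmx_congr n (X P W : 'M[R]_n) i j : hurwitz X ->
  W^T = W -> psdmx W -> lyapunov X P = - W ->
  Rintegral (@lebesgue_measure R) `[0%R, +oo[
    (fun t => expmx_congr X W t i j) = P i j.
Proof.
move=> hX Ws Wp PW.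
have Ep t : psdmx (expmx_congr X W t) by exact: psdmx_congr.
have Es t : (expmx_congr X W t)^T = expmx_congr X W t.
  by rewrite /expmx_congr !trmx_mul trmxK Ws mulmxA.
have dP k l (t : R) : is_derive t 1 (fun s => expmx_congr X P s k l)
    (- expmx_congr X W t k l).
  apply: is_derive_eq (is_derive_expmx_congr X P t k l) _.
  by rewrite PW /expmx_congr mulmxN mulNmx mx_linE.
pose tr Q (t : R) := \sum_k expmx_congr X Q t k k.
have dtr (t : R) : is_derive t 1 (tr P) (- tr W t).
  by rewrite -sumrN; apply: is_derive_sum_fun => k.
have ctr : continuous (tr W).
  by move=> t; apply: (@cvg_sum_fun R R (nbhs t)) => k; exact: continuous_expmx_congr.
have tr_lim : tr P t @[t --> +oo] --> 0.
  by apply: (@cvg0_sum_fun R R (pinfty_nbhs R)) => k; exact: expmx_congr_cvg0.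
have tr0 t : 0 <= tr W t by apply: sumr_ge0 => k _; exact: psdmx_diag_ge0.
have [itr trE] := ge0_Rintegral_derivative tr0 ctr dtr tr_lim.
pose h Q (t : R) := expmx_congr X Q t i j + tr Q t.
have dh (t : R) : is_derive t 1 (h P) (- h W t).
  have -> : h P = (fun t => expmx_congr X P t i j) + tr P by [].
  by apply: is_derive_eq; rewrite opprD.
have ch : continuous (h W).
  by move=> t; apply: cvgD; [exact: continuous_expmx_congr|exact: ctr].
have h_lim : h P t @[t --> +oo] --> 0.
  by rewrite -(addr0 0); apply: cvgD tr_lim; exact: expmx_congr_cvg0.
have h0 t : 0 <= h W t.
  have := psdmx_entry_le_trace i j (Es t) (Ep t).
  by rewrite ler_norml => /andP[+ _]; rewrite -subr_ge0 opprK.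
have [ih hE] := ge0_Rintegral_derivative h0 ch dh h_lim.
have -> : (fun t => expmx_congr X W t i j) = (fun t => h W t - tr W t).
  by apply/funext => t; rewrite /h addrK.
rewrite RintegralB//= hE trE /h addrK; by rewrite expmx_congr0.
Qed.

End LyapunovStability.

(** * Polynomial and rational functions of a matrix *)

Section PolynomialFunctions.
Variables (R : realType) (a b : nat).
Local Notation dom := 'M[R]_(a, b).
Implicit Types (f g : dom -> R) (U : set dom).

Inductive polyfun : (dom -> R) -> Prop :=
| polyfun_cst c : polyfun (fun=> c)
| polyfun_entry i j : polyfun (fun x => x i j)
| polyfunD f g : polyfun f -> polyfun g -> polyfun (fun x => f x + g x)
| polyfunM f g : polyfun f -> polyfun g -> polyfun (fun x => f x * g x).

Lemma polyfunN f : polyfun f -> polyfun (fun x => - f x).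
Proof.
move=> pf; have := polyfunM (polyfun_cst (-1)) pf.
by under eq_fun do rewrite mulN1r.
Qed.

Lemma polyfun_sum I (r : seq I) (P : pred I) (F : I -> dom -> R) :
  (forall i, P i -> polyfun (F i)) -> polyfun (fun x => \sum_(i <- r | P i) F i x).
Proof.
move=> pF; elim: r => [|i r IH].
  under eq_fun do rewrite big_nil.
  exact: polyfun_cst.
case Pi: (P i); under eq_fun do rewrite big_cons Pi; last by [].
by apply: polyfunD => //; exact: pF.
Qed.

Lemma polyfun_prod I (r : seq I) (P : pred I) (F : I -> dom -> R) :
  (forall i, P i -> polyfun (F i)) -> polyfun (fun x => \prod_(i <- r | P i) F i x).
Proof.
move=> pF; elim: r => [|i r IH].
  under eq_fun do rewrite big_nil.
  exact: polyfun_cst.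
case Pi: (P i); under eq_fun do rewrite big_cons Pi; last by [].
by apply: polyfunM => //; exact: pF.
Qed.

Lemma polyfun_differentiable f x : polyfun f -> differentiable f x.
Proof.
elim=> [c|i j|{}f g _ df _ dg|{}f g _ df _ dg].
- exact: differentiable_cst.
- exact: differentiable_coord.
- exact: differentiableD.
- exact: differentiableM.
Qed.

Lemma polyfun_continuous f : polyfun f -> continuous f.
Proof.
by move=> pf x; apply: differentiable_continuous; exact: polyfun_differentiable.
Qed.

Lemma polyfun_derivable f x v : polyfun f -> derivable f x v.
Proof. by move=> pf; apply: diff_derivable; exact: polyfun_differentiable. Qed.

Lemma derive_entry (x v : dom) i j : 'D_v (fun y : dom => y i j : R) x = v i j.
Proof.
have did : derivable (@id dom) x v by exact: derivable_id.
have := derive_mx did; rewrite derive_id => /(congr1 (fun M : dom => M i j)).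
by rewrite mxE => ->.
Qed.

Lemma polyfun_derive f v : polyfun f -> polyfun (fun x => 'D_v f x).
Proof.
elim=> [c|i j|{}f g pf df pg dg|{}f g pf df pg dg].
- under eq_fun do rewrite derive_cst.
  exact: polyfun_cst.
- under eq_fun do rewrite derive_entry.
  exact: polyfun_cst.
- rewrite (_ : (fun x => _) = fun x => 'D_v f x + 'D_v g x).
    exact: polyfunD.
  apply/funext => x; exact: (deriveD (polyfun_derivable pf) (polyfun_derivable pg)).
- rewrite (_ : (fun x => _) = fun x => f x * 'D_v g x + g x * 'D_v f x).
    by apply: polyfunD; apply: polyfunM.
  apply/funext => x; exact: (deriveM (polyfun_derivable pf) (polyfun_derivable pg)).
Qed.

(** Unlike differentiability, rationality passes to directional derivatives, so
    it carries all the second-order calculus needed here. *)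
Definition ratfun U f : Prop := exists N d : dom -> R,
  [/\ polyfun N, polyfun d & forall x, U x -> d x != 0 /\ f x = N x / d x].

Lemma ratfun_near U f x : open U -> U x -> ratfun U f ->
  exists2 g, differentiable g x & \near x, g x = f x.
Proof.
move=> oU Ux [N [d [pN pd Nd]]]; exists (N * (fun y => (d y)^-1)).
  apply: differentiableM; first exact: polyfun_differentiable.
  apply: differentiableV; first exact: polyfun_differentiable.
  by case: (Nd x Ux).
have : \forall y \near x, U y by exact: open_nbhs_nbhs.
by apply: filterS => y /Nd[_ ->].
Qed.

Lemma ratfun_derivable U f x v : open U -> U x -> ratfun U f -> derivable f x v.
Proof.
move=> oU Ux /(ratfun_near oU Ux)[g dg gf].
exact/(near_eq_derivable gf)/diff_derivable.
Qed.

Lemma ratfun_continuous U f x : open U -> U x -> ratfun U f ->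
  {for x, continuous f}.
Proof.
move=> oU Ux /(ratfun_near oU Ux)[g dg gf].
have gfx : g x = f x by exact: (nbhs_singleton gf).
have cg : g y @[y --> x] --> f x.
  by rewrite -gfx; exact: (differentiable_continuous dg).
by apply: (cvg_trans (near_eq_cvg _) cg); apply: filterS gf => y ->.
Qed.

Lemma ratfun_derive_linear U f x v : open U -> U x -> ratfun U f ->
  'D_v f x = \sum_i \sum_j v i j * 'D_(delta_mx i j) f x.
Proof.
move=> oU Ux /(ratfun_near oU Ux)[g dg gf].
rewrite -(near_eq_derive v gf) deriveE// {1}(matrix_sum_delta v) linear_sum.
apply: eq_bigr => i _; rewrite linear_sum; apply: eq_bigr => j _.
by rewrite linearZ -(near_eq_derive _ gf) deriveE.
Qed.

Lemma ratfun_derive U f v : open U -> ratfun U f -> ratfun U (fun x => 'D_v f x).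
Proof.
move=> oU [N [d [pN pd Nd]]].
exists (fun x => 'D_v N x * d x + - (N x * 'D_v d x)), (fun x => d x * d x); split.
- apply: polyfunD; first exact: polyfunM (polyfun_derive v pN) pd.
  by apply: polyfunN; exact: polyfunM pN (polyfun_derive v pd).
- exact: polyfunM.
move=> x Ux; have [dx _] := Nd x Ux; split; first by rewrite mulf_neq0.
rewrite -(@near_eq_derive _ _ _ (N * (fun y => (d y)^-1)) f x v); last first.
  have : \forall y \near x, U y by exact: open_nbhs_nbhs.
  by apply: filterS => y /Nd[_ ->].
have dd : derivable d x v := polyfun_derivable pd.
have dN : derivable N x v := polyfun_derivable pN.
have dVd : derivable (fun y => (d y)^-1) x v := derivableV dx dd.
rewrite (deriveM dN dVd).
rewrite (deriveV dx dd) /GRing.scale/=; by field.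
Qed.

End PolynomialFunctions.

Section PolynomialMatrices.
Variables (R : realType) (a b : nat).
Local Notation dom := 'M[R]_(a, b).

Definition polymx m n (F : dom -> 'M[R]_(m, n)) : Prop :=
  forall i j, polyfun (fun x => F x i j).

Lemma polymx_cst m n (M : 'M[R]_(m, n)) : polymx (fun=> M).
Proof. by move=> i j; exact: polyfun_cst. Qed.

Lemma polymx_id : polymx id.
Proof. by move=> i j; exact: polyfun_entry. Qed.

Lemma polymxD m n (F G : dom -> 'M[R]_(m, n)) :
  polymx F -> polymx G -> polymx (fun x => F x + G x).
Proof. by move=> pF pG i j; under eq_fun do rewrite mxE; exact: polyfunD. Qed.

Lemma polymxN m n (F : dom -> 'M[R]_(m, n)) : polymx F -> polymx (fun x => - F x).
Proof. by move=> pF i j; under eq_fun do rewrite mxE; exact: polyfunN. Qed.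

Lemma polymxM m n q (F : dom -> 'M[R]_(m, n)) (G : dom -> 'M[R]_(n, q)) :
  polymx F -> polymx G -> polymx (fun x => F x *m G x).
Proof.
move=> pF pG i j; under eq_fun do rewrite mxE.
by apply: polyfun_sum => k _; exact: polyfunM.
Qed.

Lemma polymx_trmx m n (F : dom -> 'M[R]_(m, n)) :
  polymx F -> polymx (fun x => (F x)^T).
Proof. by move=> pF i j; under eq_fun do rewrite mxE; exact: pF. Qed.

Lemma polyfun_trace n (F : dom -> 'M[R]_n) : polymx F -> polyfun (fun x => \tr (F x)).
Proof. by move=> pF; apply: polyfun_sum => k _; exact: pF. Qed.

Lemma polyfun_frob m n (F G : dom -> 'M[R]_(m, n)) :
  polymx F -> polymx G -> polyfun (fun x => frob (F x) (G x)).
Proof. by move=> pF pG; apply: polyfun_trace; apply: polymxM => //; exact: polymx_trmx. Qed.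

Lemma polyfun_det n (F : dom -> 'M[R]_n) : polymx F -> polyfun (fun x => \det (F x)).
Proof.
move=> pF; apply: polyfun_sum => s _; apply: polyfunM; first exact: polyfun_cst.
by apply: polyfun_prod => k _; exact: pF.
Qed.

Lemma polymx_adj n (F : dom -> 'M[R]_n) : polymx F -> polymx (fun x => \adj (F x)).
Proof.
move=> pF i j; under eq_fun do rewrite mxE /cofactor.
apply: polyfunM; first exact: polyfun_cst.
by apply: polyfun_det => k l; under eq_fun do rewrite !mxE; exact: pF.
Qed.

Lemma polymx_mxvec m n (F : dom -> 'M[R]_(m, n)) :
  polymx F -> polymx (fun x => mxvec (F x)).
Proof.
move=> pF i j; rewrite ord1; case/mxvec_indexP: j => k l.
by under eq_fun do rewrite mxvecE; exact: pF.
Qed.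

Lemma polymx_vec_mx m n (F : dom -> 'rV[R]_(m * n)) :
  polymx F -> polymx (fun x => vec_mx (F x)).
Proof. by move=> pF i j; under eq_fun do rewrite mxE; exact: pF. Qed.

Lemma polymx_lin_mulmx m n q (F : dom -> 'M[R]_(m, n)) :
  polymx F -> polymx (fun x => @lin_mulmx R m n q (F x)).
Proof.
move=> pF i j; under eq_fun do rewrite mxE /=.
apply: polymx_mxvec; apply: polymxM; try exact: polymx_cst; by [].
Qed.

Lemma polymx_lin_mulmxr m n q (F : dom -> 'M[R]_(n, q)) :
  polymx F -> polymx (fun x => @lin_mulmxr R m n q (F x)).
Proof.
move=> pF i j; under eq_fun do rewrite mxE /=.
apply: polymx_mxvec; apply: polymxM; try exact: polymx_cst; by [].
Qed.

End PolynomialMatrices.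

(** * The cost as a rational function on the open set of stabilizing gains *)

Section LyapunovSolution.
Variables (R : realType) (n : nat).
Implicit Types X P W : 'M[R]_n.

Definition lyapunov_mx X : 'M[R]_(n * n) := lin_mulmx X^T + lin_mulmxr X.

Lemma mul_lyapunov_mx X P : mxvec P *m lyapunov_mx X = mxvec (lyapunov X P).
Proof. by rewrite mulmxDr !mul_vec_lin /= -linearD. Qed.

Lemma lyapunov_mx_unit X : hurwitz X -> lyapunov_mx X \in unitmx.
Proof.
move=> hX; rewrite -row_free_unit; apply: inj_row_free => v.
rewrite -(vec_mxK v) mul_lyapunov_mx => /eqP.
by rewrite mxvec_eq0 => /eqP /(lyapunov_eq0 hX) ->; rewrite linear0.
Qed.

Definition lyapunov_sol X W : 'M[R]_n :=
  vec_mx (mxvec (- W) *m invmx (lyapunov_mx X)).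

Lemma lyapunov_solP X W : hurwitz X -> lyapunov X (lyapunov_sol X W) = - W.
Proof.
move=> hX; apply: (can_inj mxvecK).
by rewrite -mul_lyapunov_mx vec_mxK mulmxKV// lyapunov_mx_unit.
Qed.

End LyapunovSolution.

Section Cost.
Variables (R : realType) (n m p : nat).
Variables (A : 'M[R]_n) (B : 'M[R]_(n, m)) (C : 'M[R]_(p, n)).
Variables (R1 : 'M[R]_n) (R12 : 'M[R]_(n, m)) (R2 : 'M[R]_m) (D0 : 'M[R]_n).
Hypothesis hblock : posdefmx (block_mx R1 R12 R12^T R2).

Local Notation cl := (closed_loop A B C).
Local Notation W := (lqr_weight C R1 R12 R2).
Local Notation J := (lqr_cost A B C R1 R12 R2 D0).
Local Notation stab := (stabilizing A B C).
Implicit Types K : 'M[R]_(m, p).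

(** The weight is the block matrix pulled back along x |-> (x, - K C x). *)
Lemma lqr_weight_congr K : W K =
  (col_mx 1%:M (- (K *m C)))^T *m block_mx R1 R12 R12^T R2
    *m col_mx 1%:M (- (K *m C)).
Proof.
rewrite tr_col_mx mul_row_block mul_row_col trmx1 !mul1mx mulmx1.
rewrite /lqr_weight linearN/= trmx_mul !mulNmx !mulmxN mulmxDl !mulNmx.
by rewrite opprD opprK !mulmxA addrA; congr (_ + _); rewrite addrAC.
Qed.

Lemma lqr_weight_posdef K : posdefmx (W K).
Proof.
split; first by rewrite lqr_weight_congr !trmx_mul trmxK hblock.1 mulmxA.
move=> x x0; have := hblock.2 (col_mx 1%:M (- (K *m C)) *m x).
rewrite trmx_mul lqr_weight_congr !mulmxA; apply.
rewrite mul_col_mx mul1mx; apply: contra_neq x0 => /(congr1 usubmx).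
by rewrite col_mxKu linear0.
Qed.

Lemma lqr_P_eq K P : hurwitz (cl K) -> lyapunov (cl K) P = - W K ->
  lqr_P A B C R1 R12 R2 K = P.
Proof.
move=> hK PW; apply/matrixP => i j; rewrite mxE.
have Wpos := lqr_weight_posdef K.
rewrite -(Rintegral_expmx_congr i j hK Wpos.1 (posdefmx_psd Wpos) PW).
congr Rintegral; apply/funext => t.
by rewrite /lqr_integrand expmx_trmx.
Qed.

Lemma polymx_closed_loop : polymx cl.
Proof.
apply: polymxD; first exact: polymx_cst.
apply: polymxN; apply: polymxM; last exact: polymx_cst.
by apply: polymxM; [exact: polymx_cst|exact: polymx_id].
Qed.

Lemma polymx_lqr_weight : polymx W.
Proof.
have pKC : polymx (fun K : 'M[R]_(m, p) => K *m C).
  by apply: polymxM; [exact: polymx_id|exact: polymx_cst].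
have pN : polymx (fun K : 'M[R]_(m, p) => col_mx (1%:M : 'M[R]_n) (- (K *m C))).
  move=> i j; case: (splitP i) => k ik.
    have -> : i = lshift m k by apply/val_inj.
    by under eq_fun do rewrite col_mxEu; exact: polyfun_cst.
  have -> : i = rshift n k by apply/val_inj.
  by under eq_fun do rewrite col_mxEd; exact: polymxN.
move=> i j; under eq_fun do rewrite lqr_weight_congr.
apply: polymxM => //; apply: polymxM; last exact: polymx_cst.
exact: polymx_trmx.
Qed.

Lemma polymx_lyapunov_mx : polymx (fun K => lyapunov_mx (cl K)).
Proof.
apply: polymxD; last exact: polymx_lin_mulmxr polymx_closed_loop.
by apply: polymx_lin_mulmx; apply: polymx_trmx; exact: polymx_closed_loop.
Qed.

(** Cramer's rule for the linear system that determines P(K). *)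
Lemma lqr_cost_ratfun : ratfun stab J.
Proof.
pose num K := \tr (vec_mx (mxvec (- W K) *m \adj (lyapunov_mx (cl K))) *m D0).
exists num, (fun K => \det (lyapunov_mx (cl K))); split.
- apply: polyfun_trace; apply: polymxM; last exact: polymx_cst.
  apply: polymx_vec_mx; apply: polymxM; last exact: polymx_adj polymx_lyapunov_mx.
  by apply: polymx_mxvec; apply: polymxN; exact: polymx_lqr_weight.
- exact: polyfun_det polymx_lyapunov_mx.
move=> K hK; have Lu := lyapunov_mx_unit hK.
have detL : \det (lyapunov_mx (cl K)) != 0 by rewrite -unitfE -unitmxE.
split=> //; rewrite /lqr_cost (lqr_P_eq hK (lyapunov_solP (W K) hK)).
rewrite /num /lyapunov_sol /invmx Lu -scalemxAr linearZ/= -scalemxAl mxtraceZ.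
by rewrite mulrC.
Qed.

(** A matrix P solving the Lyapunov equation at K, with right-hand side - 1,
    still gives a negative definite right-hand side at nearby gains, which
    certifies that they are stabilizing. *)
Lemma open_stabilizing : open stab.
Proof.
rewrite openE => K hK.
pose P := lyapunov_sol (cl K) 1%:M.
have PE : lyapunov (cl K) P = - 1%:M by exact: lyapunov_solP.
have one_psd : psdmx (1%:M : 'M[R]_n).
  by move=> x; rewrite mulmx1; have := frob_ge0 x; rewrite /frob /mxtrace big_ord1.
have Ps : P^T = P.
  apply: (lyapunov_inj hK); rewrite lyapunov_trmx PE linearN/=.
  by rewrite trmx1.
have Pp : psdmx P by exact: lyapunov_psd hK one_psd PE.
pose E K' := lyapunov (cl K') P + 1%:M.
have pE : polymx E.
  apply: polymxD; last exact: polymx_cst.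
  apply: polymxD; apply: polymxM; try exact: polymx_cst.
    by apply: polymx_trmx; exact: polymx_closed_loop.
  exact: polymx_closed_loop.
have E0 : frob (E K) (E K) = 0 by rewrite /E PE addNr frob0l.
have : \forall K' \near K, frob (E K') (E K') < 1.
  have := polyfun_continuous (polyfun_frob pE pE) (x := K).
  move/cvgrPdist_lt => /(_ _ ltr01); apply: filterS => K'.
  rewrite E0 sub0r normrN; exact: le_lt_trans (ler_norm _).
apply: filterS => K' E1.
apply: (@hurwitz_of_lyapunov _ _ _ _ (- lyapunov (cl K') P) Ps Pp); last by rewrite opprK.
split; first by rewrite linearN/= -lyapunov_trmx Ps.
move=> x x0.
have -> : - lyapunov (cl K') P = 1%:M - E K' by apply/eqP; rewrite eq_sym subr_eq /E addKr.
have tr11 (M : 'M[R]_1) : M 0 0 = \tr M by rewrite /mxtrace big_ord1.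
have -> : (x^T *m (1%:M - E K') *m x) 0 0 = frob x x - frob x (E K' *m x).
  by rewrite mulmxBr mulmxBl mulmx1 !mx_linE !tr11 /frob -mulmxA.
have xx := frob_gt0 x0.
have := frob_abs_le x (E K' *m x).
have : frob (E K' *m x) (E K' *m x) < frob x x.
  rewrite (le_lt_trans (frob_mulmx_le _ _))//.
  by rewrite -[ltRHS]mul1r ltr_pM2r.
lra.
Qed.

End Cost.

(** * Existence of constrained minimizers *)

Section ClosedConditions.
Variables (R : realType) (a b : nat).
Local Notation dom := 'M[R]_(a, b).

Lemma closed_polyfun_ge0 (f : dom -> R) : polyfun f -> closed [set x | 0 <= f x].
Proof.
move=> pf; rewrite (_ : [set x | 0 <= f x] = f @^-1` [set y | 0 <= y]) //.
by apply: closed_comp; [move=> x _; exact: polyfun_continuous|exact: closed_ge].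
Qed.

Lemma closed_polymx_eq m n (F G : dom -> 'M[R]_(m, n)) :
  polymx F -> polymx G -> closed [set x | F x = G x].
Proof.
move=> pF pG; pose h x := - frob (F x - G x) (F x - G x).
have ph : polyfun h.
  by apply: polyfunN; apply: polyfun_frob; apply: polymxD => //; exact: polymxN.
rewrite (_ : [set x | F x = G x] = [set x | 0 <= h x]); first exact: closed_polyfun_ge0.
apply/seteqP; split => x /=; first by rewrite /h => ->; rewrite subrr frob0l oppr0.
rewrite /h oppr_ge0 => h0; apply/eqP; rewrite -subr_eq0 -frob_eq0.
by rewrite eq_le h0 frob_ge0.
Qed.

Lemma polymx_continuous m n (F : dom -> 'M[R]_(m, n)) : polymx F -> continuous F.
Proof.
by move=> pF x; apply: (@cvg_mx_entries _ _ (nbhs x)) => i j; exact: (polyfun_continuous (pF i j)).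
Qed.

End ClosedConditions.

Section Minimizers.
Variables (R : realType) (n m p : nat).
Variables (A : 'M[R]_n) (B : 'M[R]_(n, m)) (C : 'M[R]_(p, n)).
Variables (R1 : 'M[R]_n) (R12 : 'M[R]_(n, m)) (R2 : 'M[R]_m) (D0 : 'M[R]_n).
Hypotheses (hblock : posdefmx (block_mx R1 R12 R12^T R2)) (hD0 : posdefmx D0).
Hypothesis hC : \rank C = p.

Local Notation cl := (closed_loop A B C).
Local Notation W := (lqr_weight C R1 R12 R2).
Local Notation J := (lqr_cost A B C R1 R12 R2 D0).
Local Notation stab := (stabilizing A B C).

(** Taking traces in the Lyapunov equation, the left-hand side is at most
    linear in K C whereas the weight grows quadratically. *)
Lemma frob_gain_bounded (c : R) : exists b, forall K P,
  P^T = P -> frob P P <= c -> lyapunov (cl K) P = - W K -> frob K K <= b.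
Proof.
have [r r0 rW] := posdefmx_frob_le hblock.
pose bN := 2 / r * (c + frob A A + 2 / r * (c * frob B B)).
exists (bN * frob (pinvmx C) (pinvmx C)) => K P Ps Pc PW.
pose N := K *m C.
have KN : K = N *m pinvmx C.
  by rewrite /N -mulmxA mulmxVp ?mulmx1// -row_leq_rank hC.
rewrite {1 2}KN (le_trans (frob_mulmx_le _ _))// ler_wpM2r ?frob_ge0//.
pose U := (P *m B)^T.
have UU : frob U U <= c * frob B B.
  rewrite /U frob_trmx (le_trans (frob_mulmx_le _ _))// ler_wpM2r//.
  exact: frob_ge0.
have trL : \tr (lyapunov (cl K) P) = 2 * frob P A - 2 * frob U N.
  rewrite /lyapunov mxtraceD -[in X in X + _]Ps -trmx_mul mxtrace_tr.
  rewrite /closed_loop mulmxBr linearB/= /frob /U trmxK Ps /N !mulmxA; ring.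
have trW : r * frob N N <= \tr (W K).
  rewrite lqr_weight_congr (le_trans _ (rW _ _))// ler_wpM2l ?(ltW r0)//.
  rewrite [leRHS]/frob tr_col_mx mul_row_col mxtraceD -!/(frob _ _).
  by rewrite frobNr frobC frobNr opprK lerDr frob_ge0.
have PA := frob_ge0 (P + A).
have UN := frob_ge0 ((2 / r) *: U - N).
rewrite frobDr ![frob (P + A) _]frobC !frobDr [frob A P]frobC in PA.
rewrite frobBr ![frob (_ - N) _]frobC !frobBr !(frobZr, frobZl) [frob N U]frobC in UN.
have trE : \tr (W K) = - (2 * frob P A - 2 * frob U N).
  by rewrite -trL PW linearN/= opprK.
rewrite trE in trW.
have UN' : 2 * frob U N <= 2 / r * frob U U + r / 2 * frob N N.
  have r2 : 0 <= r / 2 by rewrite ltW// divr_gt0.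
  rewrite -subr_ge0; have := mulr_ge0 r2 UN; congr (0 <= _); field.
  by rewrite gt_eqF.
have r2 : 0 < 2 / r by rewrite divr_gt0.
have UU' := ler_wpM2l (ltW r2) UU.
have key : r / 2 * frob N N <= c + frob A A + 2 / r * (c * frob B B) by lra.
rewrite /bN -ler_pdivrMl// invf_div.
by rewrite (_ : r / 2 * _ = r / 2 * frob N N).
Qed.

(** A positive semidefinite solution P of the Lyapunov equation already certifies
    that K is stabilizing.  So tr (P D0) can be minimized over the pairs (K, P)
    that satisfy closed conditions only, and those below a given cost form a
    bounded set. *)
Theorem lqr_cost_attains_min (S : set 'M[R]_(m, p)) (K0 : 'M[R]_(m, p)) :
  closed S -> stab K0 -> S K0 ->
  exists K, [/\ stab K, S K & forall L, stab L -> S L -> J K <= J L].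
Proof.
move=> cS hK0 SK0.
pose V := 'rV[R]_(m * p + n * n).
pose Kof (v : V) : 'M[R]_(m, p) := vec_mx (lsubmx v).
pose Pof (v : V) : 'M[R]_n := vec_mx (rsubmx v).
have pK : polymx Kof.
  by apply: polymx_vec_mx => i j; under eq_fun do rewrite mxE; exact: polyfun_entry.
have pP : polymx Pof.
  by apply: polymx_vec_mx => i j; under eq_fun do rewrite mxE; exact: polyfun_entry.
have ptr : polyfun (fun v => \tr (Pof v *m D0)).
  by apply: polyfun_trace; apply: polymxM => //; exact: polymx_cst.
have pW : polymx (fun v => W (Kof v)).
  have pKC : polymx (fun v => Kof v *m C) by apply: polymxM => //; exact: polymx_cst.
  have pKR M : polymx (fun v => M *m Kof v *m C : 'M[R]_n).
    by apply: polymxM; [apply: polymxM => //|]; exact: polymx_cst.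
  have pCK (M : 'M[R]_(m, n)) : polymx (fun v => C^T *m (Kof v)^T *m M).
    apply: polymxM; last exact: polymx_cst.
    by apply: polymxM; [exact: polymx_cst|exact: polymx_trmx].
  rewrite /lqr_weight; apply: polymxD; [apply: polymxD; [apply: polymxD|]|].
  - exact: polymx_cst.
  - by apply: polymxN; exact: pKR.
  - by apply: polymxN; exact: pCK.
  - apply: polymxM; last exact: polymx_cst.
    apply: polymxM => //; apply: polymxM; last exact: polymx_cst.
    by apply: polymxM; [exact: polymx_cst|exact: polymx_trmx].
have pcl : polymx (fun v => cl (Kof v)).
  apply: polymxD; first exact: polymx_cst.
  apply: polymxN; apply: polymxM; last exact: polymx_cst.
  by apply: polymxM => //; exact: polymx_cst.
have pL : polymx (fun v => lyapunov (cl (Kof v)) (Pof v)).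
  by apply: polymxD; apply: polymxM => //; exact: polymx_trmx.
have [c cE] : exists c, J K0 <= c by exists (J K0).
pose Z : set V := [set v | S (Kof v)] `&` ([set v | (Pof v)^T = Pof v] `&`
  ([set v | lyapunov (cl (Kof v)) (Pof v) = - W (Kof v)] `&`
  ([set v | psdmx (Pof v)] `&` [set v | 0 <= c - \tr (Pof v *m D0)]))).
have cZ : closed Z.
  apply: closedI.
    by apply: closed_comp cS => v _; exact: polymx_continuous.
  apply: closedI; first by apply: closed_polymx_eq => //; exact: polymx_trmx.
  apply: closedI; first by apply: closed_polymx_eq => //; exact: polymxN.
  apply: closedI; last first.
    apply: closed_polyfun_ge0; apply: polyfunD; first exact: polyfun_cst.
    exact: polyfunN.
  rewrite (_ : [set v | psdmx (Pof v)] = \bigcap_(x in [set: 'cV[R]_n])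
      [set v | 0 <= (x^T *m Pof v *m x) 0 0]); last first.
    by apply/seteqP; split => v /= vP x => [_|]; apply: vP.
  apply: closed_bigI => x _; apply: closed_polyfun_ge0.
  by apply: polymxM; [apply: polymxM => //|]; exact: polymx_cst.
have sol K : stab K -> S K -> J K <= c ->
    exists2 v, Z v & Kof v = K /\ \tr (Pof v *m D0) = J K.
  move=> hK SK Jc; pose P := lyapunov_sol (cl K) (W K).
  have PW : lyapunov (cl K) P = - W K by exact: lyapunov_solP.
  have Wp := lqr_weight_posdef C hblock K.
  have Ps : P^T = P.
    by apply: (lyapunov_inj hK); rewrite lyapunov_trmx PW linearN/= Wp.1.
  have JP : J K = \tr (P *m D0) by rewrite /lqr_cost (lqr_P_eq hblock hK PW).
  exists (row_mx (mxvec K) (mxvec P)); rewrite /Z /Kof /Pof /=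
    row_mxKl row_mxKr !mxvecK -?JP //; do !split=> //.
    exact: lyapunov_psd hK (posdefmx_psd Wp) PW.
  by rewrite subr_ge0.
have Zsol v : Z v -> stab (Kof v) /\ J (Kof v) = \tr (Pof v *m D0).
  move=> [_ [Ps [PW [Pp _]]]].
  have hK : hurwitz (cl (Kof v)).
    exact: hurwitz_of_lyapunov Ps Pp (lqr_weight_posdef C hblock _) PW.
  by split => //; rewrite /lqr_cost (lqr_P_eq hblock hK PW).
have [v0 Zv0 [Kv0 _]] := sol K0 hK0 SK0 cE.
have bZ : bounded_set Z.
  have [k k0 kP] := frob_le_sqr_trace hD0.
  have [b bK] := frob_gain_bounded (k * c ^+ 2).
  pose M := Num.max (b + 1) (k * c ^+ 2 + 1).
  have entry_le (t : R) : t ^+ 2 <= b \/ t ^+ 2 <= k * c ^+ 2 -> `|t| <= M.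
    move=> tb; have : t ^+ 2 + 1 <= M.
      by case: tb => tb; rewrite le_max !lerD2r tb ?orbT.
    apply: le_trans; rewrite ler_norml; apply/andP.
    by split; have := sqr_ge0 (t - 1); have := sqr_ge0 (t + 1); nra.
  exists M; split; first exact: num_real.
  move=> M' MM' v [_ [Ps [PW [Pp]]]] /=; rewrite subr_ge0 => Pc.
  have [tr0 PP] := kP _ Ps Pp.
  have Pc2 : frob (Pof v) (Pof v) <= k * c ^+ 2.
    rewrite (le_trans PP)// ler_wpM2l// lerXn2r// nnegrE.
    exact: le_trans Pc.
  have KK := bK _ _ Ps Pc2 PW.
  have M0 : 0 <= M'.
    rewrite ltW// (le_lt_trans _ MM')// le_max; apply/orP; right.
    by rewrite addr_ge0// mulr_ge0// sqr_ge0.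
  rewrite /Num.Def.normr/= mx_normrE (bigmax_le _ M0)//= => -[i j] _ /=.
  rewrite (le_trans _ (ltW MM'))// entry_le//; rewrite ord1.
  rewrite -(hsubmxK v); case: (splitP j) => l jl.
    have -> : j = lshift (n * n) l by apply/val_inj.
    rewrite row_mxEl; case/mxvec_indexP: l jl => s t _.
    left; apply: le_trans KK.
    by have := sqr_entry_le_frob (Kof v) s t; rewrite mxE.
  have -> : j = rshift (m * p) l by apply/val_inj.
  rewrite row_mxEr; case/mxvec_indexP: l jl => s t _.
  right; apply: le_trans Pc2.
  by have := sqr_entry_le_frob (Pof v) s t; rewrite mxE.
have [v /set_mem Zv vmin] : exists2 v, v \in Z &
    forall t, t \in Z -> \tr (Pof v *m D0) <= \tr (Pof t *m D0).
  apply: (EVT_min_rV (f := fun v => \tr (Pof v *m D0))); first by exists v0.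
    exact: bounded_closed_compact.
  by apply: continuous_subspaceT; exact: polyfun_continuous.
have [hK JK] := Zsol v Zv.
exists (Kof v); split; [exact: hK|by case: Zv|].
move=> L hL SL; case/orP: (le_total (J L) c) => [Lc|cL]; last first.
  have JKc : J (Kof v) <= c.
    by rewrite JK; move: Zv => [_ [_ [_ [_ /=]]]]; rewrite subr_ge0.
  exact: le_trans JKc cL.
have [w Zw [_ <-]] := sol L hL SL Lc.
by rewrite JK; apply: vmin; exact/mem_set.
Qed.

End Minimizers.

(** * Null sets *)

Section NullSets.
Variables (R : realType) (m p : nat) (free : 'I_m -> 'I_p -> bool).
Local Notation M := 'M[R]_(m, p).
Local Notation null := (@sparse_null R m p free).
Local Notation vol := (box_volume free).
Implicit Types Z : set M.

Lemma box_volume_ge0 (a b : M) : (forall i j, a i j <= b i j) -> 0 <= vol a b.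
Proof. by move=> ab; apply: prodr_ge0 => -[i j] _ /=; rewrite subr_ge0. Qed.

Lemma nat_box_cover (T : countType) Z (e : R) (I : set T) (a b : T -> M) :
  (forall k i j, a k i j <= b k i j) ->
  Z `<=` \bigcup_(k in I) sparse_box free (a k) (b k) ->
  (\esum_(k in I) (vol (a k) (b k))%:E <= e%:E)%E ->
  exists (I : set nat) (a b : nat -> M),
    [/\ forall k i j, a k i j <= b k i j,
        Z `<=` \bigcup_(k in I) sparse_box free (a k) (b k)
      & (\esum_(k in I) (vol (a k) (b k))%:E <= e%:E)%E].
Proof.
move=> ab Zab vole.
pose lift (c : T -> M) (k : nat) : M := if unpickle k is Some t then c t else 0.
have liftE c t : lift c (pickle t) = c t by rewrite /lift pickleK.
exists (pickle @` I), (lift a), (lift b); split.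
- by move=> k i j; rewrite /lift; case: unpickle.
- move=> K /Zab[t It Kt]; exists (pickle t); first by exists t.
  by rewrite !liftE.
rewrite esum_image; last by move=> s t _ _; exact: (pcan_inj pickleK).
by under eq_esum do rewrite !liftE.
Qed.

Lemma sparse_null0 : null set0.
Proof.
move=> e e0; exists set0, (fun=> 0), (fun=> 0); split=> //.
by rewrite esum_set0 lee_fin ltW.
Qed.

Lemma sparse_nullS Z Z' : Z `<=` Z' -> null Z' -> null Z.
Proof.
move=> ZZ' nZ' e /nZ'[I [a [b [ab Z'ab vole]]]]; exists I, a, b; split=> //.
exact: subset_trans Z'ab.
Qed.

Lemma sparse_null_bigcup_nat (Z : nat -> set M) :
  (forall k, null (Z k)) -> null (\bigcup_k Z k).
Proof.
move=> nZ e e0.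
have ek k : 0 < e / (2 ^ k.+1)%:R by rewrite divr_gt0// ltr0n expn_gt0.
have /choice[I /choice[a /choice[b H]]] := fun k => nZ k _ (ek k).
apply: (@nat_box_cover (nat * nat)%type _ e (setT `*`` I)
    (fun kl => a kl.1 kl.2) (fun kl => b kl.1 kl.2)).
- by move=> k i j; case: (H k.1).
- move=> K [k _ ZK]; have [_ /(_ K ZK)[l Il Kl] _] := H k.
  by exists (k, l).
rewrite -(esum_esum (a := fun k l => (vol (a k l) (b k l))%:E)); last first.
  by move=> k l _ _; rewrite lee_fin box_volume_ge0//; case: (H k).
apply: le_trans (epsilon_trick0 xpredT (ltW e0)).
rewrite nneseries_esumT => [|k]; last by rewrite lee_fin ltW.
by apply: le_esum => k _; case: (H k).
Qed.

Lemma sparse_null_bigcup (T : countType) (Z : T -> set M) :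
  (forall t, null (Z t)) -> null (\bigcup_t Z t).
Proof.
move=> nZ; apply: (@sparse_nullS _
    (\bigcup_k (if unpickle k is Some t then Z t else set0))).
  by move=> K [t _ ZK]; exists (pickle t) => //; rewrite pickleK.
by apply: sparse_null_bigcup_nat => k; case: unpickle => // ; exact: sparse_null0.
Qed.

(** Over the entries other than (k, l), cut the cube of side s into cells of
    side s / N.  The part of Z over one cell lies in a slab of height
    2 Lam s / N around any of its points, so the total volume is O(1 / N). *)
Lemma sparse_null_lipschitz_graph Z (k : 'I_m) (l : 'I_p) (c0 : M) (s Lam : R) :
  free k l -> 0 < s -> 0 <= Lam -> Z `<=` sparse free ->
  (forall K, Z K -> forall i j, free i j -> c0 i j <= K i j <= c0 i j + s) ->
  (forall K L e, Z K -> Z L -> 0 <= e ->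
    (forall i j, (i, j) != (k, l) -> `|K i j - L i j| <= e) ->
    `|K k l - L k l| <= Lam * e) ->
  null Z.
Proof.
move=> fkl s0 L0 Zs Zc Zl e e0.
pose V : R := \prod_(ij | ij != (k, l)) (if free ij.1 ij.2 then s else 1).
have V0 : 0 <= V by apply: prodr_ge0 => ij _; case: ifP => // _; exact: ltW.
pose N' := Num.bound (2 * Lam * s * V / e); pose N := N'.+1.
have N0 : (0 : R) < N%:R by rewrite ltr0n.
have VN : 2 * Lam * (s / N%:R) * V <= e.
  have q0 : 0 <= 2 * Lam * s * V / e.
    by rewrite divr_ge0 ?(ltW e0)// !mulr_ge0 ?(ltW s0).
  have : 2 * Lam * s * V / e <= N%:R.
    by rewrite (le_trans (ltW (archi_boundP q0)))// ler_nat.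
  rewrite ler_pdivrMr// => H.
  rewrite (_ : _ * V = 2 * Lam * s * V / N%:R); last by ring.
  by rewrite ler_pdivrMr// [leRHS]mulrC.
pose d := s / N%:R; have d0 : 0 < d by rewrite divr_gt0.
pose cells ij := free ij.1 ij.2 && (ij != (k, l)).
pose Q ij : pred 'I_N := if cells ij then predT else pred1 ord0.
pose T := {ffun 'I_m * 'I_p -> 'I_N}.
pose cell (f : T) : set M := [set K | Z K /\ forall ij, cells ij ->
  c0 ij.1 ij.2 + (f ij)%:R * d <= K ij.1 ij.2 <= c0 ij.1 ij.2 + (f ij).+1%:R * d].
pose rep f := xget 0 (cell f).
pose a (f : T) : M := \matrix_(i, j)
  if (i, j) == (k, l) then rep f k l - Lam * d else c0 i j + (f (i, j))%:R * d.
pose b (f : T) : M := \matrix_(i, j)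
  if (i, j) == (k, l) then rep f k l + Lam * d else c0 i j + (f (i, j)).+1%:R * d.
have Ld0 : 0 <= Lam * d by rewrite mulr_ge0// ltW.
apply: (@nat_box_cover T _ e [set` family Q] a b).
- move=> f i j; rewrite !mxE; case: ifP => _; first by rewrite lerBlDr -addrA lerDl addr_ge0.
  by rewrite lerD2l ler_wpM2r ?(ltW d0)// ler_nat.
- move=> K ZK.
  pose x ij := (K ij.1 ij.2 - c0 ij.1 ij.2) / d.
  pose f : T := [ffun ij => if cells ij then inord (minn (Num.trunc (x ij)) N') else ord0].
  have fcell : cell f K.
    split=> // ij cij; rewrite ffunE cij inordK; last by rewrite ltnS geq_minr.
    have /andP[fij _] := cij; have /andP[cK Kc] := Zc K ZK _ _ fij.
    have x0 : 0 <= x ij by rewrite divr_ge0 ?subr_ge0// ltW.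
    have xN : x ij <= N%:R.
      rewrite /x ler_pdivrMr// /d mulrCA mulfV ?gt_eqF// mulr1 lerBlDl.
      exact: Kc.
    have -> : K ij.1 ij.2 = c0 ij.1 ij.2 + x ij * d.
      by rewrite /x divfK ?gt_eqF// addrC subrK.
    have /andP[t1 t2] := truncn_itv x0.
    rewrite !lerD2l !ler_pM2r//; apply/andP; split.
      by rewrite (le_trans _ t1)// ler_nat geq_minl.
    rewrite minnE; case: (leqP (Num.trunc (x ij)) N') => tN.
      by move/eqP: tN => ->; rewrite subn0 ltW.
    by rewrite subKn// ltnW.
  have frep : cell f (rep f) by exact: xgetI fcell.
  exists f.
    apply/familyP => ij; rewrite /Q; case: ifP => // cij.
    by rewrite inE ffunE cij.
  split; first exact: Zs.
  move=> i j fij; rewrite !mxE; case: ifP => [/eqP[-> ->]|ijkl]; last first.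
    by have := fcell.2 (i, j); rewrite /cells /= fij ijkl; apply.
  rewrite -ler_distl; apply: Zl => //; [by case: frep|exact: ltW|].
  move=> i' j' ij'; case fij': (free i' j'); last first.
    by rewrite !Zs ?subrr ?normr0 ?(ltW d0) ?fij'//; case: frep.
  have cij : cells (i', j') by rewrite /cells fij' ij'.
  have /andP[u1 u2] := fcell.2 _ cij; have /andP[u3 u4] := frep.2 _ cij.
  rewrite /= -natr1 mulrDl mul1r in u1 u2 u3 u4.
  by rewrite ler_norml; apply/andP; split; lra.
rewrite esum_fset//; last first.
  by move=> f _; rewrite lee_fin box_volume_ge0// => i j; rewrite !mxE;
     case: ifP => _; [rewrite lerBlDr -addrA lerDl addr_ge0
                     |rewrite lerD2l ler_wpM2r ?(ltW d0)// ler_nat].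
rewrite -(bigfs _ (index_enum_uniq T)); last by move=> f _; rewrite mem_index_enum.
rewrite sumEFin lee_fin; apply: le_trans VN.
pose G (ij : 'I_m * 'I_p) (_ : 'I_N) : R :=
  if free ij.1 ij.2 then (if ij == (k, l) then 2 * Lam * d else d) else 1.
have volE f : vol (a f) (b f) = \prod_ij G ij (f ij).
  rewrite /box_volume big_mkcond; apply: eq_bigr => -[i j] _; rewrite /G /=.
  case: ifP => // _; rewrite !mxE; case: ifP => _; first by ring.
  by rewrite -natr1; ring.
under eq_bigr do rewrite volE.
rewrite -(bigA_distr_big_dep Q G) (bigD1 (k, l))//= mulrC.
rewrite le_eqVlt; apply/orP; left; apply/eqP; rewrite [RHS]mulrC; congr (_ * _).
  apply: eq_bigr => ij ijkl; rewrite /Q /cells /G ijkl andbT (negbTE ijkl).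
  case: ifP => _; last by rewrite big_pred1_eq.
  by rewrite sumr_const card_ord -mulr_natl /d mulrCA mulfV ?gt_eqF// mulr1.
by rewrite /Q /cells /G eqxx andbF fkl big_pred1_eq.
Qed.

End NullSets.

(** * Null sets of critical points *)

Section Lines.
Variables (R : realType) (V : normedModType R).

Lemma is_derive_line (f : V -> R) (x v : V) (t : R) :
  derivable f (x + t *: v) v ->
  is_derive t 1 (fun s => f (x + s *: v)) ('D_v f (x + t *: v)).
Proof.
have E : (fun h : R => h^-1 *: (((fun s => f (x + s *: v)) \o shift t) (h *: 1)
      - f (x + t *: v))) =
    (fun h => h^-1 *: ((f \o shift (x + t *: v)) (h *: v) - f (x + t *: v))).
  apply/funext => h /=; congr (_ *: (f _ - _)).
  rewrite (_ : h *: (1 : R) = h); last exact: mulr1.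
  by rewrite scalerDl addrCA.
move=> dfx; split; first by rewrite /derivable E.
by rewrite /derive E.
Qed.

Lemma MVT_line (f : V -> R) (x v : V) (t : R) : 0 < t ->
  (forall s, 0 <= s <= t -> derivable f (x + s *: v) v) ->
  exists2 s, 0 < s < t & f (x + t *: v) - f x = t * 'D_v f (x + s *: v).
Proof.
move=> t0 df.
have dl s : 0 <= s <= t ->
    is_derive s 1 (fun s => f (x + s *: v)) ('D_v f (x + s *: v)).
  by move=> /df; exact: is_derive_line.
have [s||s st E] := @MVT _ (fun s => f (x + s *: v))
    (fun s => 'D_v f (x + s *: v)) 0 t t0.
- by rewrite in_itv/= => /andP[s0 st]; apply: dl; rewrite !ltW.
- apply: derivable_within_continuous => s; rewrite in_itv/= => st.
  by case: (dl s st).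
exists s; first by rewrite in_itv in st.
by move: E; rewrite scale0r addr0 subr0 mulrC.
Qed.

End Lines.

Section MatrixNeighbourhoods.
Variables (R : realType) (m p : nat).
Local Notation M := 'M[R]_(m, p).

Lemma nbhs_mx_entries (K : M) (U : set M) : nbhs K U ->
  exists2 r : R, 0 < r & forall L : M, (forall i j, `|L i j - K i j| < r) -> U L.
Proof.
move=> /nbhs_ballP[r /= r0 rU]; exists r => // L KL; apply: rU.
by split=> // i j; rewrite /ball/= distrC; exact: KL.
Qed.

Lemma mx_entries_nbhs (K : M) (r : R) : 0 < r ->
  \forall L \near K, forall i j, `|(L : M) i j - K i j| < r.
Proof.
move=> r0; apply/nbhs_ballP; exists r => //= L [_ KL] i j.
by have := KL i j; rewrite /ball/= distrC.
Qed.

(** These cubes form a countable basis of the topology. *)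
Definition rat_cube (ck : 'M[rat]_(m, p) * nat) : set M :=
  [set K | forall i j, `|K i j - ratr (ck.1 i j)| < ck.2.+1%:R^-1].

Lemma rat_cube_basis (K : M) (U : set M) : nbhs K U ->
  exists2 ck, rat_cube ck K & rat_cube ck `<=` U.
Proof.
move=> /nbhs_mx_entries[r r0 rU].
pose k := Num.bound (2 / r).
have k0 : 0 < k.+1%:R^-1 :> R by rewrite invr_gt0 ltr0n.
have kr : k.+1%:R^-1 + k.+1%:R^-1 <= r.
  have r2 : 0 <= 2 / r by rewrite divr_ge0// ltW.
  have : 2 / r <= k.+1%:R.
    by rewrite (le_trans (ltW (archi_boundP r2)))// ler_nat.
  rewrite ler_pdivrMr// => H.
  rewrite (_ : _ + _ = 2 / k.+1%:R); last by ring.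
  by rewrite ler_pdivrMr ?ltr0n// mulrC.
have : forall ij : 'I_m * 'I_p, exists q : rat, `|K ij.1 ij.2 - ratr q| < k.+1%:R^-1.
  move=> ij; have : K ij.1 ij.2 - k.+1%:R^-1 < K ij.1 ij.2 + k.+1%:R^-1.
    by rewrite ltrBlDr -addrA ltrDl addr_gt0.
  move=> /rat_in_itvoo[q]; rewrite in_itv/= => /andP[q1 q2]; exists q.
  by rewrite ltr_distlC q1 q2.
move=> /choice[q Hq]; exists (\matrix_(i, j) q (i, j), k).
  by move=> i j; rewrite mxE; exact: (Hq (i, j)).
move=> L HL; apply: rU => i j; have := HL i j; have := Hq (i, j); rewrite mxE /=.
move=> Kq Lq; apply: le_lt_trans (ler_distD (ratr (q (i, j))) _ _) _.
by apply: lt_le_trans kr; apply: ltrD => //; rewrite distrC.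
Qed.

End MatrixNeighbourhoods.

Section NullCritical.
Variables (R : realType) (m p : nat) (free : 'I_m -> 'I_p -> bool).
Local Notation M := 'M[R]_(m, p).
Local Notation null := (@sparse_null R m p free).
Local Notation sparse := (@sparse R m p free).
Implicit Types (Z U D : set M) (h J : M -> R).

(** Countably many rational cubes suffice to cover Z (Lindelof). *)
Lemma sparse_null_local Z :
  (forall K, Z K -> exists2 U, nbhs K U & null (Z `&` U)) -> null Z.
Proof.
move=> H; pose T := ('M[rat]_(m, p) * nat)%type.
pose P (t : T) := `[< null (Z `&` @rat_cube R m p t) >].
apply: (@sparse_nullS _ _ _ _ _
  (\bigcup_(t : T) (if P t then Z `&` @rat_cube R m p t else set0))).
  move=> K ZK; have [U KU nU] := H K ZK.
  have [t Kt tU] := rat_cube_basis KU; exists t => //.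
  have -> : P t by apply/asboolP; apply: sparse_nullS nU; exact: setIS.
  by [].
apply: sparse_null_bigcup => t; case: ifPn => [/asboolP//|_].
exact: sparse_null0.
Qed.

Lemma sparse_null_subsingleton Z (k : 'I_m) (l : 'I_p) : free k l ->
  Z `<=` sparse -> (forall K L, Z K -> Z L -> K = L) -> null Z.
Proof.
move=> fkl Zs ZZ; have [->|/set0P[K ZK]] := eqVneq Z set0; first exact: sparse_null0.
apply: (@sparse_null_lipschitz_graph _ _ _ _ _ k l K 1 0) => //.
- by move=> L ZL i j _; rewrite (ZZ L K ZL ZK) lexx lerDl ler01.
- by move=> L L' e ZL ZL' e0 _; rewrite (ZZ L L') // subrr normr0 mul0r.
Qed.

(** Strict local minimizers need not be isolated, but each is the only point
    of some rational cube that is minimal there. *)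
Lemma sparse_null_strict_minimizers J D (k : 'I_m) (l : 'I_p) : free k l ->
  D `<=` sparse -> null (strict_local_minimizer J D).
Proof.
move=> fkl Ds; pose T := ('M[rat]_(m, p) * nat)%type.
apply: (@sparse_nullS _ _ _ _ _ (\bigcup_(t : T) [set K | [/\ D K,
    @rat_cube R m p t K & forall L, D L -> rat_cube t L -> L != K -> J K < J L]])).
  move=> K [DK KJ]; have [t Kt tU] := rat_cube_basis KJ.
  by exists t => //; split=> // L DL tL LK; exact: (tU L tL DL LK).
apply: sparse_null_bigcup => t; apply: sparse_null_subsingleton fkl _ _.
  by move=> K [DK _ _]; exact: Ds.
move=> K L [DK Kt KJ] [DL Lt LJ]; apply/eqP; apply: contraT => KL.
have := lt_trans (KJ L DL Lt _) (LJ K DK Kt KL).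
by rewrite ltxx eq_sym => /(_ KL).
Qed.

Lemma derive_sparse U h (K V : M) : open U -> U K -> ratfun U h -> sparse V ->
  'D_V h K = \sum_i \sum_j if free i j then V i j * 'D_(delta_mx i j) h K else 0.
Proof.
move=> oU UK rh sV; rewrite (ratfun_derive_linear _ oU UK rh).
apply: eq_bigr => i _; apply: eq_bigr => j _; case: ifP => // fij.
by rewrite sV ?fij// mul0r.
Qed.

(** By the mean value theorem the zero set of h is, near a point where the
    (k, l) derivative does not vanish, a Lipschitz graph over the other
    entries. *)
Lemma sparse_null_regular_zeros U h (k : 'I_m) (l : 'I_p) : open U ->
  ratfun U h -> free k l ->
  null [set K | [/\ U K, sparse K, h K = 0 & 'D_(delta_mx k l) h K != 0]].
Proof.
move=> oU rh fkl; apply: sparse_null_local => K0 [UK0 sK0 hK0 dK0].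
pose D ij K := 'D_(delta_mx ij.1 ij.2) h K.
have cD ij : {for K0, continuous (D ij)}.
  exact: ratfun_continuous oU UK0 (ratfun_derive _ oU rh).
pose c := `|D (k, l) K0|; have c0 : 0 < c by rewrite normr_gt0.
pose b := \sum_ij `|D ij K0| + 1.
have b0 : 0 <= b by rewrite addr_ge0// sumr_ge0.
have near_ub : \forall K \near K0, forall ij, `|D ij K| <= b.
  apply: (@filter_forall _ _ _ (nbhs K0)) => ij; have /cvgrPdist_le := cD ij.
  move=> /(_ _ ltr01); apply: filterS => K HK.
  have : `|D ij K| <= `|D ij K0| + 1.
    rewrite -lerBlDl (le_trans _ HK)// distrC.
    exact: lerB_dist.
  move=> /le_trans; apply; rewrite lerD2r (bigD1 ij)//= lerDl sumr_ge0//.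
have near_lb : \forall K \near K0, c / 2 <= `|D (k, l) K|.
  have c2 : 0 < c / 2 by rewrite divr_gt0.
  have /cvgrPdist_le := cD (k, l); move=> /(_ _ c2); apply: filterS => K HK.
  have := le_trans (lerB_dist _ _) HK; rewrite -/c; lra.
have near_U : \forall K \near K0, U K by exact: open_nbhs_nbhs.
have [r r0 rH] := nbhs_mx_entries (filterI near_U (filterI near_ub near_lb)).
exists [set K | forall i j, `|K i j - K0 i j| < r]; first exact: mx_entries_nbhs.
pose Lam := b * (m * p)%:R / (c / 2).
apply: (@sparse_null_lipschitz_graph _ _ _ _ _ k l (\matrix_(i, j) (K0 i j - r))
    (2 * r) Lam) => //.
- by rewrite mulr_gt0.
- by rewrite divr_ge0 ?mulr_ge0// ltW// divr_gt0.
- by move=> K [[]].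
- move=> K [_ Kr] i j _; rewrite mxE; have := Kr i j; rewrite ltr_norml.
  by move=> /andP[? ?]; apply/andP; split; lra.
move=> K L e [[UK sK hK _] Kr] [[UL sL hL _] Lr] e0 KLe.
pose V := K - L.
have sV : sparse V by move=> i j fij; rewrite !mxE sK// sL// subrr.
have seg s : 0 <= s <= 1 -> forall i j, `|(L + s *: V) i j - K0 i j| < r.
  move=> /andP[s0 s1] i j; rewrite !mxE.
  have -> : L i j + s * (K i j - L i j) - K0 i j =
      s * (K i j - K0 i j) + (1 - s) * (L i j - K0 i j) by ring.
  pose q := Num.max `|K i j - K0 i j| `|L i j - K0 i j|.
  have qr : q < r by rewrite gt_max Kr Lr.
  rewrite (le_lt_trans _ qr)// (le_trans (ler_normD _ _))// !normrM.
  have s1' : 0 <= 1 - s by rewrite subr_ge0.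
  rewrite (ger0_norm s0) (ger0_norm s1').
  have -> : q = s * q + (1 - s) * q by ring.
  apply: lerD; apply: ler_wpM2l => //.
    by rewrite /q le_max lexx.
  by rewrite /q le_max lexx orbT.
have [|s /andP[s0 s1] E] := @MVT_line _ _ h L V 1 ltr01.
  move=> s /seg /rH[Us _]; exact: ratfun_derivable oU Us rh.
have {}E : 'D_V h (L + s *: V) = 0.
  have LV : L + 1 *: V = K by rewrite scale1r /V addrC subrK.
  by rewrite -[LHS]mul1r -E LV hK hL subrr.
have s01 : 0 <= s <= 1 by rewrite !ltW.
have [Us [ub lb]] := rH _ (seg s s01).
move: E; set X := L + s *: V in Us ub lb *; rewrite (ratfun_derive_linear _ oU Us rh).
rewrite pair_bigA (bigD1 (k, l))//= => /eqP; rewrite addr_eq0 => /eqP E.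
have : `|V k l| * (c / 2) <= b * (m * p)%:R * e.
  apply: (@le_trans _ _ (`|V k l| * `|D (k, l) X|)); first by rewrite ler_wpM2l.
  rewrite -normrM E normrN (le_trans (ler_norm_sum _ _ _))//.
  apply: (@le_trans _ _ (\sum_(ij : 'I_m * 'I_p) b * e)).
    rewrite [leRHS](bigD1 (k, l))//= ler_wpDl ?mulr_ge0//.
    apply: ler_sum => -[i j] ijkl; rewrite normrM mulrC /=.
    by rewrite ler_pM// /V ?(ub (i, j))// !mxE; exact: KLe.
  rewrite sumr_const card_prod !card_ord -mulr_natl; lra.
rewrite /V !mxE -ler_pdivlMr ?divr_gt0// => /le_trans; apply.
by rewrite /Lam mulrAC.
Qed.

End NullCritical.

(** * Descent paths *)

Section DescentPaths.
Variables (R : realType) (m p : nat) (free : 'I_m -> 'I_p -> bool).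
Local Notation M := 'M[R]_(m, p).
Local Notation sparse := (@sparse R m p free).
Variables (U : set M) (f : M -> R).
Hypotheses (oU : open U) (rf : ratfun U f).
Hypothesis fmin : forall (S : set M) K0, closed S -> U K0 -> S K0 ->
  exists K, [/\ U K, S K & forall L, U L -> S L -> f K <= f L].

Local Notation g := (gradient free f).
Local Notation D := (U `&` sparse).

Lemma sparseD (V W : M) : sparse V -> sparse W -> sparse (V + W).
Proof. by move=> sV sW i j fij; rewrite mxE sV// sW// addr0. Qed.

Lemma sparseZ a (V : M) : sparse V -> sparse (a *: V).
Proof. by move=> sV i j fij; rewrite mxE sV// mulr0. Qed.

Lemma sparseB (V W : M) : sparse V -> sparse W -> sparse (V - W).
Proof. by move=> sV sW; rewrite -scaleN1r; apply: sparseD => //; exact: sparseZ. Qed.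

Lemma sparse_gradient K : sparse (g K).
Proof. by move=> i j /negbTE fij; rewrite mxE fij. Qed.

Lemma closed_sparse : closed sparse.
Proof.
rewrite (_ : sparse = [set K | proj_sparse free K = K]).
  apply: closed_polymx_eq; last exact: polymx_id.
  move=> i j; case: (boolP (free i j)) => fij.
    under eq_fun do rewrite mxE fij.
    exact: polyfun_entry.
  under eq_fun do rewrite mxE (negbTE fij).
  exact: polyfun_cst.
apply/seteqP; split => K /=.
  by move=> sK; apply/matrixP => i j; rewrite mxE; case: ifPn => // /sK.
by move=> E i j /negbTE fij; rewrite -E mxE fij.
Qed.

Lemma frob_gradient K V : U K -> sparse V -> frob (g K) V = 'D_V f K.
Proof.
move=> UK sV; rewrite (derive_sparse oU UK rf sV) frobE.
do 2![apply: eq_bigr => ? _]; rewrite !mxE; case: ifP => _; last by rewrite mul0r.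
exact: mulrC.
Qed.

Lemma ratfun_gradient i j : ratfun U (fun K => g K i j).
Proof.
case: (boolP (free i j)) => fij.
  under eq_fun do rewrite !mxE fij.
  exact: ratfun_derive.
under eq_fun do rewrite !mxE (negbTE fij).
exists (fun=> 0), (fun=> 1); split; [exact: polyfun_cst|exact: polyfun_cst|].
by move=> x _; rewrite oner_neq0 mul0r.
Qed.

Lemma near_line (K V : M) (P : set M) : nbhs K P ->
  exists2 t : R, 0 < t & forall s, 0 <= s <= t -> P (K + s *: V).
Proof.
move=> /nbhs_mx_entries[r r0 rP].
pose b := \sum_ij `|V ij.1 ij.2| + 1.
have b0 : 0 < b by rewrite ltr_wpDl// sumr_ge0.
exists (r / b); first by rewrite divr_gt0.
move=> s /andP[s0 st]; apply: rP => i j; rewrite !mxE addrAC subrr add0r normrM ger0_norm//.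
rewrite (le_lt_trans (ler_wpM2r _ st))// mulrAC ltr_pdivrMr// ltr_pM2l//.
by rewrite /b (bigD1 (i, j))//= -addrA ltrDl ltr_wpDl// sumr_ge0.
Qed.

(** Along a ray from a strict minimizer the function first rises, so its
    derivative is positive somewhere. *)
Lemma strict_minimizer_ray K V : strict_local_minimizer f D K -> sparse V ->
  V != 0 -> exists s, [/\ 0 < s, D (K + s *: V) & 0 < 'D_V f (K + s *: V)].
Proof.
move=> [[UK sK] minK] sV V0.
have nearU : \forall L \near K, U L by exact: open_nbhs_nbhs.
have [t t0 tP] := near_line V (filterI nearU minK).
have [|s /andP[s0 st] E] := @MVT_line _ _ f K V t t0.
  by move=> s /tP[Us _]; exact: ratfun_derivable oU Us rf.
have s0t : 0 <= s <= t by rewrite !ltW.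
exists s; split=> //.
  by split; [case: (tP s s0t)|apply: sparseD => //; exact: sparseZ].
have tt : 0 <= t <= t by rewrite lexx ltW.
have [Ut Lt] := tP t tt.
have : f K < f (K + t *: V).
  apply: Lt; first by split=> //; apply: sparseD => //; exact: sparseZ.
  by rewrite -subr_eq0 addrAC subrr add0r scaler_eq0 negb_or V0 gt_eqF.
by rewrite -subr_gt0 E pmulr_rgt0.
Qed.

Lemma descent_ray K V : U K -> 'D_V f K < 0 ->
  exists s, [/\ 0 < s, U (K + s *: V) & f (K + s *: V) < f K].
Proof.
move=> UK dV.
have nearU : \forall L \near K, U L by exact: open_nbhs_nbhs.
have cD : {for K, continuous (fun L => 'D_V f L)}.
  exact: ratfun_continuous oU UK (ratfun_derive _ oU rf).
have near_neg : \forall L \near K, 'D_V f L < 0 by exact: (cvgr_lt _ cD).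
have [t t0 tP] := near_line V (filterI nearU near_neg).
have [|s /andP[s0 st] E] := @MVT_line _ _ f K V t t0.
  by move=> s /tP[Us _]; exact: ratfun_derivable oU Us rf.
have [|Ut _] := tP t; first by rewrite lexx ltW.
exists t; split=> //; rewrite -subr_lt0 E pmulr_rlt0//.
by case: (tP s) => //; rewrite !ltW.
Qed.

Lemma hessianN K V : U K -> hessian free f K (- V) = - hessian free f K V.
Proof.
move=> UK; have dg W : derivable g K W.
  apply/derivable_mxP => i j; exact: ratfun_derivable oU UK (ratfun_gradient i j).
apply/matrixP => i j; rewrite /hessian !derive_mx// !mxE.
rewrite !(ratfun_derive_linear _ oU UK (ratfun_gradient i j)) -sumrN.
apply: eq_bigr => k _; rewrite -sumrN; apply: eq_bigr => l _.
by rewrite mxE mulNr.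
Qed.

(** The derivative of f along V vanishes at K and is itself strictly decreasing
    there, so f decreases just after K. *)
Lemma saddle_ray K V (l : R) : U K -> g K = 0 -> sparse V -> V != 0 -> l < 0 ->
  hessian free f K V = l *: V ->
  exists s, [/\ 0 < s, U (K + s *: V) & f (K + s *: V) < f K].
Proof.
move=> UK gK sV V0 l0 hV; pose psi L := 'D_V f L.
have nearU : \forall L \near K, U L by exact: open_nbhs_nbhs.
have dg i j : derivable (fun L => g L i j) K V.
  exact: ratfun_derivable oU UK (ratfun_gradient i j).
have hVE i j : 'D_V (fun L => g L i j) K = l * V i j.
  have dgm : derivable g K V by apply/derivable_mxP.
  by have := congr1 (fun N : M => N i j) hV; rewrite /hessian derive_mx// !mxE.
have dpsi : is_derive K V psi (l * frob V V).
  pose F : M -> R := \sum_i \sum_j (V i j \*: (fun L => g L i j)).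
  have psiE : \forall L \near K, F L = psi L.
    apply: filterS nearU => L UL.
    rewrite /F /psi -frob_gradient// frobE fct_sumE; apply: eq_bigr => i _.
    by rewrite fct_sumE; apply: eq_bigr => j _; rewrite /= mulrC.
  apply: (near_eq_is_derive psiE).
  rewrite frobE mulr_sumr.
  apply: is_derive_sum => i; rewrite mulr_sumr; apply: is_derive_sum => j.
  have dij : is_derive K V (fun L => g L i j) (l * V i j).
    by rewrite -hVE; exact: derivableP.
  apply: is_derive_eq; rewrite /GRing.scale/=; ring.
have [dps dE] := dpsi.
have neg : l * frob V V < 0 by rewrite nmulr_rlt0// frob_gt0.
have psiK : psi K = 0 by rewrite /psi -frob_gradient// gK frob0l.
have lim_psi : h^-1 *: (psi (h *: V + K) - psi K) @[h --> 0^'] --> l * frob V V.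
  by rewrite -dE; exact: dps.
have near_neg : \forall h \near 0^', h^-1 *: (psi (h *: V + K) - psi K) < 0.
  exact: (cvgr_lt _ lim_psi).
have [e /= e0 eP] := near_neg.
have [t t0 tU] := near_line V nearU.
pose u := Num.min t (e / 2).
have u0 : 0 < u by rewrite lt_min t0 divr_gt0.
have uU s : 0 <= s <= u -> U (K + s *: V).
  by move=> /andP[s0 su]; apply: tU; rewrite s0 (le_trans su)// ge_min lexx.
have [|s /andP[s0 su] E] := @MVT_line _ _ f K V u u0.
  by move=> s /uU Us; exact: ratfun_derivable oU Us rf.
exists u; split=> //; first by apply: uU; rewrite lexx ltW.
rewrite -subr_lt0 E pmulr_rlt0// -/(psi _).
have : s^-1 *: (psi (s *: V + K) - psi K) < 0.
  apply: eP; last by rewrite gt_eqF.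
  rewrite /ball/= sub0r normrN gtr0_norm// (lt_le_trans su)//.
  by rewrite ge_min; apply/orP; right; rewrite ler_pdivrMr// ler_peMr ?ler1n// ltW.
by rewrite psiK subr0 addrC /GRing.scale/= pmulr_rlt0// invr_gt0.
Qed.

Lemma finite_descent_path_cons K L K1 : D K -> frob (g K) (L - K) < 0 ->
  D L -> finite_descent_path free f D L K1 -> finite_descent_path free f D K K1.
Proof.
move=> DK gKL DL [N [u [u0 uN uD us]]].
exists N.+1, (fun k => if k is k'.+1 then u k' else K); split=> //.
  by case=> [_|k] //; rewrite ltnS; exact: uD.
case=> [_|k]; last by rewrite ltnS; exact: us.
exists 1, (L - K); rewrite u0 scale1r; split=> //; split=> //.
by apply: sparseB; [case: DL|case: DK].
Qed.

Section Reach.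
Variable Kstar : M.
Hypothesis Kmin : global_minimizer f D Kstar.

(** Requiring at least one step makes this set relatively open, because the first
    step is then a strict inequality that persists nearby. *)
Inductive reaches : M -> Prop :=
| reaches_last K : D K -> frob (g K) (Kstar - K) < 0 -> reaches K
| reaches_step K L : D K -> frob (g K) (L - K) < 0 -> reaches L -> reaches K.

Lemma reachesD K : reaches K -> D K.
Proof. by case. Qed.

Lemma reaches_path K : reaches K -> finite_descent_path free f D K Kstar.
Proof.
elim=> [{}K DK gK|{}K L DK gK RL IH].
  apply: finite_descent_path_cons DK gK Kmin.1 _.
  by exists 0%N, (fun=> Kstar); split=> [||k _|k] //; exact: Kmin.1.
by apply: finite_descent_path_cons IH => //; exact: reachesD.
Qed.

Lemma descent_step_open K X W : D K -> frob (g K) (X - K) < 0 -> sparse W ->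
  exists e : R, [/\ 0 < e, D (K + e *: W) &
    frob (g (K + e *: W)) (X - (K + e *: W)) < 0].
Proof.
move=> [UK sK] gK sW.
have nearU : \forall L \near K, U L by exact: open_nbhs_nbhs.
have cont : frob (g L) (X - L) @[L --> K] --> frob (g K) (X - K).
  rewrite frobE; under eq_cvg do rewrite frobE.
  apply: (@cvg_sum_fun _ _ (nbhs K)) => i; apply: (@cvg_sum_fun _ _ (nbhs K)) => j.
  apply: cvgM; first exact: ratfun_continuous oU UK (ratfun_gradient i j).
  apply: (@polyfun_continuous _ _ _ (fun L : M => (X - L) i j)).
  by apply: polymxD; [exact: polymx_cst|apply: polymxN; exact: polymx_id].
have near0 : \forall L \near K, frob (g L) (X - L) < 0 by exact: (cvgr_lt _ cont).
have [t t0 tP] := near_line W (filterI nearU near0).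
have tt : 0 <= t <= t by rewrite lexx ltW.
have [Ut gt] := tP t tt; exists t; split=> //; split=> //.
by apply: sparseD => //; exact: sparseZ.
Qed.

Lemma reaches_open K W : reaches K -> sparse W ->
  exists2 e : R, 0 < e & reaches (K + e *: W).
Proof.
case=> [{}K DK gK|{}K L DK gK RL] sW; have [e [e0 De ge]] := descent_step_open DK gK sW;
  exists e => //; [exact: reaches_last|exact: reaches_step RL].
Qed.

(** No reached gain can lie in the open half-space of descent of an unreached
    one, nor on its boundary since the set of reached gains is open. *)
Lemma not_reaches_halfspace K L : D K -> ~ reaches K -> g K != 0 -> reaches L ->
  0 < frob (g K) (L - K).
Proof.
move=> DK nK gK0 RL.
have [e e0 Re] := reaches_open RL (sparseZ (-1) (sparse_gradient K)).
have ge0 : 0 <= frob (g K) (L + e *: (-1 *: g K) - K).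
  by rewrite leNgt; apply/negP => /(reaches_step DK) /(_ Re).
rewrite (_ : _ - K = L - K - e *: g K) in ge0; last first.
  by rewrite scaleN1r scalerN addrAC.
rewrite frobBr frobZr subr_ge0 in ge0; apply: lt_le_trans ge0.
by rewrite mulr_gt0// frob_gt0.
Qed.

Hypothesis hsaddle : strict_saddle_property free f D.
Hypothesis hstrict :
  forall K, local_minimizer f D K -> strict_local_minimizer f D K.

Lemma global_minimizer_strict : strict_local_minimizer f D Kstar.
Proof.
have [DK KL] := Kmin; apply: hstrict; split=> //.
by apply: (@filterS _ (nbhs Kstar) _ setT) => [L _ DL|]; [exact: KL|exact: filterT].
Qed.

(** If K is not reached, all reached gains lie strictly on the ascent side of
    the hyperplane through K normal to the gradient; minimize f over the
    opposite closed half-space, at K'.  If K' is not critical, moving from K'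
    straight away from a reached gain stays in the half-space, so minimality
    puts that gain outside the ascent side of K'; but K' is unreached, and all
    reached gains lie on its ascent side.  If K' is a saddle, an
    eigenvector with negative eigenvalue, up to sign, points into the half-space
    and decreases f.  If K' is a local minimizer other than the target, some
    gain on the ray from K' pointing away from the target descends straight to
    the target; hence it is on the ascent side, the target on the descent side
    of K, and K itself steps to the target.  If K' is the target, some
    gain on the ray from it along the negative gradient of K descends straight
    to it, although it lies on the descent side of K. *)
Lemma noncritical_reaches K : D K -> g K != 0 -> reaches K.
Proof.
move=> DK G0; apply: contrapT => nK; have [UK sK] := DK.
set G := g K in G0; have sG : sparse G := sparse_gradient K.
have Rpos L : reaches L -> 0 < frob G (L - K) by exact: not_reaches_halfspace.
pose H : set M := [set L | frob G (L - K) <= 0].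
have cH : closed (sparse `&` H).
  apply: closedI; first exact: closed_sparse.
  rewrite (_ : H = [set L | 0 <= - frob G (L - K)]).
    apply: closed_polyfun_ge0; apply: polyfunN; apply: polyfun_frob.
      exact: polymx_cst.
    by apply: polymxD; [exact: polymx_id|exact: polymx_cst].
  by apply/seteqP; split => L /=; rewrite oppr_ge0.
have HK : H K by rewrite /H /= subrr frobC frob0l.
have [K' [UK' [sK' HK'] minK']] := fmin cH UK (conj sK HK).
have DK' : D K' by split.
have nK' : ~ reaches K'.
  by move=> /Rpos; rewrite ltNge => /negP; apply.
have H_ray s W : 0 <= s -> frob G W <= 0 -> H (K' + s *: W).
  move=> s0 W0; rewrite /H /= addrAC frobDr frobZr.
  by have HK'2 : frob G (K' - K) <= 0 := HK'; have := mulr_ge0_le0 s0 W0; lra.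
(* From its strict minimizer f rises along - G, and at a point where it does,
   the direction back to the minimizer is one of descent. *)
have [L0 RL0 L0E] : exists2 L0, reaches L0 & exists2 s, 0 < s & L0 = Kstar - s *: G.
  have sNG : sparse (- G) by rewrite -scaleN1r; exact: sparseZ.
  have NG0 : - G != 0 by rewrite oppr_eq0.
  have [s [s0 Ds ds]] := strict_minimizer_ray global_minimizer_strict sNG NG0.
  rewrite scalerN in Ds ds; exists (Kstar - s *: G); last by exists s.
  apply: reaches_last => //.
  have -> : Kstar - (Kstar - s *: G) = s *: G by rewrite opprB addrC subrK.
  move: ds; rewrite -frob_gradient//; last by case: Ds.
  by rewrite frobNr oppr_gt0 frobZr pmulr_rlt0.
have K'crit : g K' = 0.
  apply/eqP; apply: contraT => gK'0.
  have gL0 := not_reaches_halfspace DK' nK' gK'0 RL0.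
  have [t t0 tU] := near_line (K' - L0) (open_nbhs_nbhs (conj oU UK')).
  have sW : sparse (K' - L0).
    by apply: sparseB => //; case: (reachesD RL0).
  have GW : frob G (K' - L0) <= 0.
    have RL0' := Rpos _ RL0; have K'0 : frob G (K' - K) <= 0 := HK'.
    by rewrite !frobBr in RL0' K'0 *; lra.
  have psi0 : 'D_(K' - L0) f K' < 0.
    by rewrite -frob_gradient// -opprB frobNr oppr_lt0.
  have [s [s0 Us fs]] := descent_ray UK' psi0.
  have := minK' _ Us (conj (sparseD sK' (sparseZ s sW)) (H_ray _ _ (ltW s0) GW)).
  by rewrite leNgt fs.
have [K'loc|[l l0 [V [sV V0 hV]]]] := hsaddle (conj DK' K'crit); last first.
  wlog GV : V sV V0 hV / frob G V <= 0.
    move=> W; case: (lerP (frob G V) 0) => [|GV]; first exact: W.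
    apply: (W (- V)); rewrite ?oppr_eq0 ?frobNr ?oppr_le0 ?(ltW GV)//.
      by rewrite -scaleN1r; exact: sparseZ.
    by rewrite hessianN// hV scalerN.
  have [s [s0 Us fs]] := saddle_ray UK' K'crit sV V0 l0 hV.
  have := minK' _ Us (conj (sparseD sK' (sparseZ s sV)) (H_ray _ _ (ltW s0) GV)).
  by rewrite leNgt fs.
have K'min := hstrict K'loc.
have GK' : frob G (K' - K) <= 0 := HK'.
have [K'E|K'K] := eqVneq K' Kstar.
  have [s s0 L0s] := L0E; have := Rpos _ RL0; rewrite L0s -K'E addrAC frobBr frobZr.
  by have := mulr_gt0 s0 (frob_gt0 G0); lra.
pose v := Kstar - K'.
have sv : sparse (- v) by rewrite opprB; apply: sparseB => //; case: Kmin => -[].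
have v0 : - v != 0 by rewrite oppr_eq0 subr_eq0 eq_sym.
have [s [s0 Ds ds]] := strict_minimizer_ray K'min sv v0.
have RL : reaches (K' + s *: (- v)).
  apply: reaches_last => //.
  have -> : Kstar - (K' + s *: (- v)) = (1 + s) *: v.
    by rewrite opprD scalerN opprK addrA scalerDl scale1r.
  move: ds; rewrite -frob_gradient//; last by case: Ds.
  by rewrite frobNr oppr_gt0 frobZr pmulr_rlt0// addr_gt0.
have := Rpos _ RL; rewrite addrAC frobDr frobZr frobNr => Gv.
apply: nK; apply: reaches_last => //.
have -> : Kstar - K = (K' - K) + v by rewrite /v [RHS]addrC addrA subrK.
rewrite -/G frobDr.
have sGv : s * frob G v < 0 by rewrite mulrN in Gv; lra.
by rewrite pmulr_rlt0// in sGv; lra.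
Qed.

End Reach.

(** Strict minimizers are countable.  Saddles are zeros of an entry of the
    gradient at which some derivative of that entry does not vanish.  One point is
    left out because with no free entry a single point is not null. *)
Lemma sparse_null_critical (Kstar : M) : D Kstar ->
  strict_saddle_property free f D ->
  (forall K, local_minimizer f D K -> strict_local_minimizer f D K) ->
  sparse_null free [set K | critical_point free f D K /\ K != Kstar].
Proof.
move=> DKs hsaddle hstrict.
have [[k [l fkl]]|nofree] := pselect (exists k l, free k l); last first.
  apply: sparse_nullS (sparse_null0 free) => K [[[_ sK] _] /eqP[]].
  apply/matrixP => i j; have fij : ~~ free i j by apply/negP => fij; apply: nofree; exists i, j.
  by rewrite sK// (DKs.2 i j).
pose T := option (('I_m * 'I_p) * ('I_m * 'I_p)).
pose Z (q : ('I_m * 'I_p) * ('I_m * 'I_p)) := [set K | [/\ U K, sparse K,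
  g K q.1.1 q.1.2 = 0 & 'D_(delta_mx q.2.1 q.2.2) (fun L => g L q.1.1 q.1.2) K != 0]].
apply: (@sparse_nullS _ _ _ _ _ (\bigcup_(t : T) (if t is Some q then
    (if free q.2.1 q.2.2 then Z q else set0) else strict_local_minimizer f D))).
  move=> K [Kc _]; have [[UK sK] gK] := Kc.
  have [/hstrict Kmin|[l' l'0 [V [sV V0 hV]]]] := hsaddle K Kc; first by exists None.
  have [i [j Vij]] : exists i j, V i j != 0.
    apply: contrapT => H; case/eqP: V0; apply/matrixP => i j; rewrite mxE.
    by apply: contrapT => /eqP Vij; apply: H; exists i, j.
  have dg : derivable g K V.
    apply/derivable_mxP => a b; exact: ratfun_derivable oU UK (ratfun_gradient a b).
  have : 'D_V (fun L => g L i j) K != 0.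
    have := congr1 (fun N : M => N i j) hV; rewrite /hessian derive_mx// !mxE => ->.
    by rewrite mulf_neq0// lt_eqF.
  rewrite (derive_sparse oU UK (ratfun_gradient i j) sV) => dV.
  have [a [b [fab dab]]] : exists a b, free a b /\
      'D_(delta_mx a b) (fun L => g L i j) K != 0.
    apply: contrapT => H; case/eqP: dV; apply: big1 => a _; apply: big1 => b _.
    case: ifP => // fab; have [->|dab] := eqVneq ('D_(delta_mx a b) (fun L => g L i j) K) 0.
      by rewrite mulr0.
    by case: H; exists a, b.
  exists (Some ((i, j), (a, b))) => //=; rewrite fab; split=> //=.
  by rewrite gK mxE.
apply: sparse_null_bigcup => -[q|]; last first.
  by apply: sparse_null_strict_minimizers fkl _ => K [].
case: ifP => fq; last exact: sparse_null0.
exact: sparse_null_regular_zeros oU (ratfun_gradient _ _) fq.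
Qed.

(** The exceptional set consists of the critical points other than the target. *)
Theorem descent_path_off_null_set :
  strict_saddle_property free f D ->
  (forall K, local_minimizer f D K -> strict_local_minimizer f D K) ->
  exists N : set M, [/\ N `<=` D, sparse_null free N
    & forall K0, (D `\` N) K0 ->
        exists2 Kstar, global_minimizer f D Kstar & descent_path free f D K0 Kstar].
Proof.
move=> hsaddle hstrict.
have [[K1 [UK1 sK1]]|D_empty] := pselect (exists K, D K); last first.
  exists set0; split=> [//||K [DK _]]; first exact: sparse_null0.
  by case: D_empty; exists K.
have [Kstar [UKs sKs minKs]] := fmin closed_sparse UK1 sK1.
have gmin : global_minimizer f D Kstar.
  by split=> [//|L [UL sL]]; exact: minKs.
exists [set K | critical_point free f D K /\ K != Kstar]; split.
- by move=> K [[]].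
- exact: sparse_null_critical gmin.1 hsaddle hstrict.
move=> K [DK NK]; exists Kstar => //; left.
have [->|KKs] := eqVneq K Kstar.
  by exists 0%N, (fun=> Kstar); split=> [||k _|k] //; exact: gmin.1.
apply: (reaches_path gmin); apply: (noncritical_reaches gmin hsaddle hstrict DK).
by apply/eqP => gK; apply: NK.
Qed.

End DescentPaths.

Unset Implicit Arguments.

Theorem theorem1 (R : realType) (n m p : nat)
    (A : 'M[R]_n) (B : 'M[R]_(n, m)) (C : 'M[R]_(p, n))
    (R1 : 'M[R]_n) (R12 : 'M[R]_(n, m)) (R2 : 'M[R]_m) (D0 : 'M[R]_n)
    (free : 'I_m -> 'I_p -> bool)
    (J := lqr_cost A B C R1 R12 R2 D0)
    (D := stabilizing A B C `&` sparse (R:=R) free)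
    (hD0 : posdefmx D0) (hR1 : R1^T = R1) (hR2 : posdefmx R2)
    (hC : \rank C = p)
    (hblock : posdefmx (block_mx R1 R12 R12^T R2))
    (hsaddle : strict_saddle_property free J D)
    (hstrict : forall K, local_minimizer J D K -> strict_local_minimizer J D K) :
  exists N : set 'M[R]_(m, p),
    [/\ N `<=` D, sparse_null free N
      & forall K0, (D `\` N) K0 ->
          exists2 Kstar, global_minimizer J D Kstar
                       & descent_path free J D K0 Kstar].
Proof.
apply: descent_path_off_null_set hsaddle hstrict.
- exact: open_stabilizing.
- exact: lqr_cost_ratfun.
- exact: lqr_cost_attains_min.
Qed.
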